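(* Consider the stochastic variational inequality problem SVI$(X,F)$ with solution set $X^*$. Suppose that: (A1) at each iteration $k$, almost surely $\mathbb{E}[w_k\mid\mathcal F_k]=0$ and $\mathbb{E}[w_{k+1/2}\mid\mathcal F_{k+1/2}]=0$; (A2) there exists $\nu>0$ such that for all $k$, almost surely $\mathbb{E}[\|w_k\|^2\mid\mathcal F_k]\le\nu^2$ and $\mathbb{E}[\|w_{k+1/2}\|^2\mid\mathcal F_{k+1/2}]\le\nu^2$; (A3) $\sum_{k=0}^\infty\gamma_k^2<\infty$; (A4) $\sum_{k=0}^\infty\gamma_k=\infty$; (A5) there exist $L,B>0$ such that $\|F(x)-F(y)\|\le L\|x-y\|$ and $\|F(x)\|\le B/2$ for all $x,y\in X$. Let $\gamma_k=\gamma_0/k$, where $\gamma_0$ is a finite scalar. Let $F$ be a monotone map over $X$, let $F$ and $X^*$ possess the weak-sharpness property with constant $\alpha$, and let $X$ be compact such that $\|x\|\le U$ for all $x\in X$. Suppose $\{x_k\}$ is generated by the extragradient scheme (ESA). Then the following hold. (a) For any $k>0$, $$\mathbb{E}[\mathrm{dist}^2(x_k,X^* )]\le\frac{M(\gamma_0)}{k},$$ where $M(\gamma_0)$ is a suitably defined scalar (not depending on $k$). (b) In addition, if $\gamma_0=(2-\epsilon)/(2\bar\sigma)$ and $\bar\sigma:=\frac{\alpha}{2U}$, where $\epsilon\in(0,1/2)$, and $s_0^*$ is a suitably defined positive scalar (not depending on $k$), then $$\mathbb{E}[\mathrm{dist}^2(x_k,X^* )]\le\frac1k\max\left\{\frac{7s_0^*}{4\bar\sigma^2},\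 \mathrm{dist}^2(x_0,X^* )\right\}.$$
   Context: Let $X\subseteq\mathbb{R}^n$ be closed and convex, $\xi:\Omega\to\mathbb{R}^d$ a random vector on a probability space, $F(x;\omega):=F(x,\xi(\omega))\in\mathbb{R}^n$ and $F(x):=\mathbb{E}[F(x;\omega)]$ (componentwise). SVI$(X,F)$ is the problem of finding $x^*\in X$ with $(x-x^* )^TF(x^* )\ge 0$ for all $x\in X$; its solution set is $X^*$. $\Pi_X$ is Euclidean projection onto $X$, $\|\cdot\|$ is the Euclidean norm, and $\mathrm{dist}(x,X^* ):=\min_{z\in X^*}\|x-z\|$. Extragradient stochastic approximation scheme (ESA): given $x_0\in X$ and a steplength sequence $\{\gamma_k\}$, for $k\ge 0$, $$x_{k+1/2}:=\Pi_X\big(x_k-\gamma_k(F(x_k)+w_k)\big),\qquad x_{k+1}:=\Pi_X\big(x_k-\gamma_k(F(x_{k+1/2})+w_{k+1/2})\big),$$ where $\omega_k,\omega_{k+1/2}$ are the samples drawn at iteration $k$, $w_k:=F(x_k;\omega_k)-F(x_k)$ and $w_{k+1/2}:=F(x_{k+1/2};\omega_{k+1/2})-F(x_{k+1/2})$. The histories are $\mathcal F_k:=\sigma\{x_0,\omega_0,\omega_{1/2},\omega_1,\dots,\omega_{k-1/2}\}$ and $\mathcal F_{k+1/2}:=\mathcal F_k\cup\{\omega_k\}$ (understood as the generated $\sigma$-algebra). The step used at $k=0$ is $\gamma_0$ itself, and $\gamma_k=\gamma_0/k$ for $k\ge1$. Monotone over $X$: $(x-y)^T(F(x)-F(y))\ge0$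 for all $x,y\in X$. Weak sharpness with constant $\alpha>0$: $(x-x^* )^TF(x^* )\ge\alpha\min_{z\in X^*}\|x-z\|$ for all $x\in X$ and all $x^*\in X^*$. *)

(* Defs.v *)
From mathcomp Require Import all_boot all_order all_algebra.
From mathcomp Require Import all_classical all_reals all_analysis.

Set Implicit Arguments.
Unset Strict Implicit.
Unset Printing Implicit Defensive.

Import Order.TTheory GRing.Theory Num.Theory.
Import numFieldNormedType.Exports.

Local Open Scope classical_set_scope.
Local Open Scope ring_scope.

(* Points of R^n are row vectors.  The library norm `|x| on 'rV[R]_n is the
   sup norm, which induces the same topology but is not the norm meant here. *)
Definition dotv (R : realType) (n : nat) (u v : 'rV[R]_n) : R :=
  \sum_(i < n) u ord0 i * v ord0 i.

Definition enorm (R : realType) (n : nat) (u : 'rV[R]_n) : R :=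
  Num.sqrt (dotv u u).

(* For S nonempty and closed the infimum is a minimum; for S empty it is 0. *)
Definition dist (R : realType) (n : nat) (x : 'rV[R]_n) (S : set 'rV[R]_n) : R :=
  inf [set enorm (x - z) | z in S].

(* Only meaningful when X is nonempty, closed and convex: the minimizer then
   exists and is unique. *)
Definition proj (R : realType) (n : nat) (X : set 'rV[R]_n) (x : 'rV[R]_n) :
    'rV[R]_n :=
  xget 0 [set p | X p /\ forall z, X z -> enorm (x - p) <= enorm (x - z)].

Definition borelV (R : realType) (n : nat) : Type :=
  g_sigma_algebraType (@open 'rV[R]_n).

Definition SVI_sol (R : realType) (n : nat) (X : set 'rV[R]_n)
    (F : 'rV[R]_n -> 'rV[R]_n) : set 'rV[R]_n :=
  [set xs | X xs /\ forall x, X x -> 0 <= dotv (x - xs) (F xs)].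

Definition monotone_over (R : realType) (n : nat) (X : set 'rV[R]_n)
    (F : 'rV[R]_n -> 'rV[R]_n) : Prop :=
  forall x y, X x -> X y -> 0 <= dotv (x - y) (F x - F y).

Definition weakly_sharp (R : realType) (n : nat) (X : set 'rV[R]_n)
    (F : 'rV[R]_n -> 'rV[R]_n) (alpha : R) : Prop :=
  forall x xs, X x -> SVI_sol X F xs ->
    alpha * dist x (SVI_sol X F) <= dotv (x - xs) (F xs).

Definition mean_map (R : realType) (n d : nat) (dO : measure_display)
    (Omega : measurableType dO) (P0 : probability Omega R)
    (xi : Omega -> 'rV[R]_d) (Fs : 'rV[R]_n -> 'rV[R]_d -> 'rV[R]_n)
    (x : 'rV[R]_n) : 'rV[R]_n :=
  \row_i \int[P0]_o (Fs x (xi o) ord0 i).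

(* Z is a version of E[Y | G], for a sub-sigma-algebra G. *)
Definition is_cond_exp (R : realType) (dT : measure_display)
    (T : measurableType dT) (P : probability T R) (G : set (set T))
    (Y Z : T -> R) : Prop :=
  [/\ P.-integrable setT (EFin \o Y),
      P.-integrable setT (EFin \o Z),
      preimage_set_system setT Z measurable `<=` G &
      forall A, G A ->
        (\int[P]_(t in A) (Z t)%:E = \int[P]_(t in A) (Y t)%:E)%E].

(* A vector-valued W, componentwise: E[W | G] = 0 almost surely. *)
Definition cond_mean_zero (R : realType) (n : nat) (dT : measure_display)
    (T : measurableType dT) (P : probability T R) (G : set (set T))
    (W : T -> 'rV[R]_n) : Prop :=
  forall i : 'I_n, exists2 Z : T -> R,
    is_cond_exp P G (fun t => W t ord0 i) Z & {ae P, forall t, Z t = 0}.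

(* E[||W||^2 | G] <= nu^2 almost surely. *)
Definition cond_sqnorm_le (R : realType) (n : nat) (dT : measure_display)
    (T : measurableType dT) (P : probability T R) (G : set (set T))
    (W : T -> 'rV[R]_n) (nu : R) : Prop :=
  exists2 Z : T -> R,
    is_cond_exp P G (fun t => enorm (W t) ^+ 2) Z &
    {ae P, forall t, Z t <= nu ^+ 2}.

(* om k stands for omega_k and omh k for omega_{k+1/2}; likewise x k and xh k
   below. *)
Definition history (R : realType) (n : nat) (dO dT : measure_display)
    (Omega : measurableType dO) (T : measurableType dT)
    (x0 : T -> 'rV[R]_n) (om omh : nat -> T -> Omega) (k : nat) :
    set (set T) :=
  <<s preimage_set_system setT (x0 : T -> borelV R n) measurable `|`
      \bigcup_(j in `I_k) (preimage_set_system setT (om j) measurable `|`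
                           preimage_set_system setT (omh j) measurable) >>.

Definition half_history (R : realType) (n : nat) (dO dT : measure_display)
    (Omega : measurableType dO) (T : measurableType dT)
    (x0 : T -> 'rV[R]_n) (om omh : nat -> T -> Omega) (k : nat) :
    set (set T) :=
  <<s history x0 om omh k `|` preimage_set_system setT (om k) measurable >>.

Definition noise (R : realType) (n d : nat) (Omega T : Type)
    (F : 'rV[R]_n -> 'rV[R]_n) (Fs : 'rV[R]_n -> 'rV[R]_d -> 'rV[R]_n)
    (xi : Omega -> 'rV[R]_d) (x : T -> 'rV[R]_n) (om : T -> Omega) (t : T) :
    'rV[R]_n :=
  Fs (x t) (xi (om t)) - F (x t).

Definition is_ESA (R : realType) (n d : nat) (Omega T : Type)
    (X : set 'rV[R]_n) (F : 'rV[R]_n -> 'rV[R]_n)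
    (Fs : 'rV[R]_n -> 'rV[R]_d -> 'rV[R]_n) (xi : Omega -> 'rV[R]_d)
    (gamma : nat -> R) (om omh : nat -> T -> Omega)
    (x xh : nat -> T -> 'rV[R]_n) : Prop :=
  forall k t,
    xh k t = proj X (x k t -
      gamma k *: (F (x k t) + noise F Fs xi (x k) (om k) t)) /\
    x k.+1 t = proj X (x k t -
      gamma k *: (F (xh k t) + noise F Fs xi (xh k) (omh k) t)).

Definition steplength (R : realType) (gamma0 : R) (k : nat) : R :=
  if k == 0%N then gamma0 else gamma0 / k%:R.

(* Main.v *)
Require Import Defs.
From mathcomp Require Import all_boot all_order all_algebra.
From mathcomp Require Import all_classical all_reals all_analysis.
From mathcomp Require Import measurable_realfun ring lra.

Set Implicit Arguments.
Unset Strict Implicit.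
Unset Printing Implicit Defensive.

Import Order.TTheory GRing.Theory Num.Theory.
Import numFieldNormedType.Exports.

Local Open Scope classical_set_scope.
Local Open Scope ring_scope.

(** Write S for the solution set, d_k for the distance from x_k to S, and w', v
for the error and the iterate at the half step.  If S is empty then d_k = 0 by
the convention on the infimum, and both bounds are trivial.  Otherwise, F being
monotone and Lipschitz, S coincides with the set of Minty solutions, so it is
compact and convex and the projection of x_k onto S is a measurable function of
the past.  Taking that projection xs as the reference solution, the variational
characterisation of the two projections in the extragradient step, monotonicity
and weak sharpness give the pathwise inequality ([sqr_dist_extragradient])

  d_{k+1}^2 <= d_k^2 - 2 gamma_k alpha d_k
     + gamma_k^2 (alpha^2 + 3 (B^2 + |w_k|^2 + |w'_k|^2)) - 2 gamma_k <w'_k, v - xs>.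

The last term has mean zero, because v - xs is bounded and measurable for the
half-step history ([cond_mean_zero_orthogonal]).  The inequality is used through
a Lyapunov function phi of d_k^2 ([expected_lyapunov_step]): if phi is
nondecreasing and satisfies a quadratic upper Taylor bound on [0, 4 U^2], then
E phi(d_k^2) decreases by 2 gamma_k alpha E[phi'(d_k^2) d_k], up to an error
O(gamma_k^2).  A scalar recursion a_{k+1} <= (1 - 3/(2k)) a_k + q/k^2 gives
a_k = O(1/k) ([recursion_rate]).

For part (b), phi is the identity: d_k <= 2U turns the drift into
2 gamma0 sigma / k = (2 - epsilon) / k >= 3/(2k).

For part (a), gamma0 is an arbitrary positive number and the identity only
gives the rate k^(- gamma0 alpha / U), which may be slower than 1/k.  The drift
2 gamma_k alpha d_k is however linear in d_k and not quadratic, and the choice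
phi(b) = exp(lam b) - 1 with lam = (alpha gamma0)^(-2) exploits this: one has
alpha gamma0 phi'(d^2) d >= phi(d^2) for every d >= 0, hence a relative drift of
2/k, and d^2 <= phi(d^2) / lam. *)

(** * Euclidean inner product and norm *)

Section inner_product.
Context {R : realType} {n : nat}.
Implicit Types (u v w : 'rV[R]_n) (a : R).

Lemma dotvC u v : dotv u v = dotv v u.
Proof. by apply: eq_bigr => i _; rewrite mulrC. Qed.

Lemma dotvDl u v w : dotv (u + v) w = dotv u w + dotv v w.
Proof. by rewrite -big_split; apply: eq_bigr => i _; rewrite mxE mulrDl. Qed.

Lemma dotvZl a u v : dotv (a *: u) v = a * dotv u v.
Proof. by rewrite mulr_sumr; apply: eq_bigr => i _; rewrite mxE mulrA. Qed.

Lemma dotvNl u v : dotv (- u) v = - dotv u v.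
Proof. by rewrite -scaleN1r dotvZl mulN1r. Qed.

Lemma dotvDr u v w : dotv w (u + v) = dotv w u + dotv w v.
Proof. by rewrite dotvC dotvDl !(dotvC w). Qed.

Lemma dotvZr a u v : dotv v (a *: u) = a * dotv v u.
Proof. by rewrite dotvC dotvZl dotvC. Qed.

Lemma dotvNr u v : dotv v (- u) = - dotv v u.
Proof. by rewrite dotvC dotvNl dotvC. Qed.

Definition dotvE := (dotvDl, dotvDr, dotvNl, dotvNr, dotvZl, dotvZr).

Lemma dotv_ge0 u : 0 <= dotv u u.
Proof. by apply: sumr_ge0 => i _; rewrite -expr2 sqr_ge0. Qed.

Lemma enorm_ge0 u : 0 <= enorm u.
Proof. exact: sqrtr_ge0. Qed.

Lemma sqr_enorm u : enorm u ^+ 2 = dotv u u.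
Proof. by rewrite sqr_sqrtr// dotv_ge0. Qed.

Lemma enorm0 : enorm (0 : 'rV[R]_n) = 0.
Proof. by rewrite /enorm -(scale0r 0) dotvZl mul0r sqrtr0. Qed.

Lemma enormN u : enorm (- u) = enorm u.
Proof. by rewrite /enorm dotvNl dotvNr opprK. Qed.

Lemma enormB u v : enorm (u - v) = enorm (v - u).
Proof. by rewrite -enormN opprB. Qed.

Lemma coord_le_enorm u i : `|u ord0 i| <= enorm u.
Proof.
rewrite -ler_sqr ?nnegrE ?enorm_ge0// sqr_enorm real_normK ?num_real//.
rewrite /dotv (bigD1 i)//= -expr2 lerDl.
by apply: sumr_ge0 => j _; rewrite -expr2 sqr_ge0.
Qed.

Lemma enorm_eq0 u : enorm u = 0 -> u = 0.
Proof.
move=> u0; apply/rowP => i; apply/eqP.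
rewrite mxE -normr_le0; apply: le_trans (coord_le_enorm u i) _.
by rewrite u0.
Qed.

Lemma dotv_cauchy_schwarz u v : dotv u v <= enorm u * enorm v.
Proof.
have H (x y : 'rV[R]_n) : enorm x = 0 -> dotv x y = 0.
  by move=> /enorm_eq0 ->; rewrite -(scale0r 0) dotvZl mul0r.
have [u0|u0] := eqVneq (enorm u) 0; first by rewrite u0 mul0r H.
have [v0|v0] := eqVneq (enorm v) 0; first by rewrite v0 mulr0 dotvC H.
have ab0 : 0 < enorm u * enorm v.
  by rewrite mulr_gt0// lt_def enorm_ge0 ?u0 ?v0.
have := dotv_ge0 (enorm v *: u - enorm u *: v).
rewrite !dotvE (dotvC v u) -!sqr_enorm => h.
rewrite -(ler_pM2l ab0); lra.
Qed.

Lemma enormD u v : enorm (u + v) <= enorm u + enorm v.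
Proof.
rewrite -ler_sqr ?nnegrE ?addr_ge0 ?enorm_ge0// sqrrD !sqr_enorm !dotvE (dotvC v u).
have := dotv_cauchy_schwarz u v; lra.
Qed.

Lemma enormZ a u : 0 <= a -> enorm (a *: u) = a * enorm u.
Proof.
move=> a0; rewrite /enorm dotvZl dotvZr mulrA -expr2 sqrtrM ?sqr_ge0//.
by rewrite sqrtr_sqr ger0_norm.
Qed.

Lemma sqr_enormD_le u v : enorm (u + v) ^+ 2 <= 2 * (enorm u ^+ 2 + enorm v ^+ 2).
Proof.
rewrite !sqr_enorm; have := dotv_ge0 (u - v).
rewrite !dotvE (dotvC v u); lra.
Qed.

Lemma sqr_enormD3_le u v w :
  enorm (u + v + w) ^+ 2 <= 3 * (enorm u ^+ 2 + enorm v ^+ 2 + enorm w ^+ 2).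
Proof.
rewrite !sqr_enorm.
have := dotv_ge0 (u - v); have := dotv_ge0 (u - w); have := dotv_ge0 (v - w).
rewrite !dotvE (dotvC v u) (dotvC w u) (dotvC w v); lra.
Qed.

Lemma enormB_continuous v : continuous (fun u => enorm (u - v)).
Proof.
have ci i : continuous (fun u : 'rV[R]_n => u ord0 i - v ord0 i).
  move=> u; apply: (@cvgB R R^o _ (nbhs u)); last exact: cvg_cst.
  exact: coord_continuous.
have cdot : continuous (fun u : 'rV[R]_n => dotv (u - v) (u - v)).
  rewrite (_ : (fun u => _) = fun u => \sum_(i < n)
    (u ord0 i - v ord0 i) * (u ord0 i - v ord0 i)).
    apply: continuous_big => [|i _ u]; first exact: add_continuous.
    exact: (cvgM (ci i u) (ci i u)).
  by apply/funext => u; apply: eq_bigr => i _; rewrite !mxE.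
by move=> u; exact: (continuous_comp (cdot u) (@sqrt_continuous R _)).
Qed.

(** Lipschitz estimates for the Euclidean norm yield continuity for the topology
of ['rV[R]_n], which is generated by the sup norm. *)
Lemma enorm_lipschitz_continuous (f : 'rV[R]_n -> R) (k : R) :
  (forall u v, `|f u - f v| <= k * enorm (u - v)) -> continuous f.
Proof.
move=> flip u.
have h e : 0 < e -> \forall v \near u, `|f u - f v| <= e.
  move=> e0.
  have k0 : 0 < `|k| + 1 by rewrite ltr_wpDl.
  have := @enormB_continuous u u; rewrite /continuous_at subrr enorm0.
  move=> /cvgrPdist_le /(_ _ (divr_gt0 e0 k0)); apply: filterS => v /=.
  rewrite sub0r normrN ger0_norm ?enorm_ge0// enormB ler_pdivlMr// mulrC.
  apply: le_trans; apply: (le_trans (flip u v)).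
  by rewrite ler_wpM2r ?enorm_ge0// (le_trans (ler_norm k))// lerDl.
exact: (proj2 (@cvgrPdist_le R R^o _ (nbhs u) _ f (f u)) h).
Qed.

End inner_product.

(** * Projection onto a compact convex set *)

Lemma le0_of_small_le {R : realFieldType} (a b : R) :
  (forall t, 0 < t <= 1 -> a <= t * b) -> a <= 0.
Proof.
move=> h; rewrite leNgt; apply/negP => a0.
have b0 : 0 < b by have := h 1; rewrite mul1r ltr01 lexx => /(_ isT); lra.
have ab : a <= b by have := h 1; rewrite mul1r ltr01 lexx => /(_ isT).
have := h (a / (2 * b)).
rewrite divr_gt0 ?mulr_gt0//= ler_pdivrMr ?mulr_gt0// mul1r.
have -> : a <= 2 * b by lra.
have -> : a / (2 * b) * b = a / 2 by field; rewrite gt_eqF.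
by move=> /(_ isT); lra.
Qed.

Section projection.
Context {R : realType} {n : nat}.
Variables (X : set 'rV[R]_n).
Hypotheses (X_convex : convex_set X) (X_compact : compact X) (X_neq0 : X !=set0).
Implicit Types (x y z p : 'rV[R]_n).

Lemma proj_in_min x :
  X (Defs.proj X x) /\ forall z, X z -> enorm (x - Defs.proj X x) <= enorm (x - z).
Proof.
rewrite /Defs.proj; case: xgetP => [p _ //|/(_ _)] h; exfalso.
have [|p pX pmin] := @EVT_min_rV R n (fun z => enorm (x - z)) X X_neq0 X_compact.
  apply: continuous_subspaceT => z.
  rewrite [X in continuous_at _ X](_ : _ = fun z => enorm (z - x)).
    exact: enormB_continuous.
  by apply/funext => y; exact: enormB.
apply: (h p); split; first exact: set_mem.
by move=> z Xz; apply: pmin; exact: mem_set.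
Qed.

Lemma proj_in x : X (Defs.proj X x).
Proof. by case: (proj_in_min x). Qed.

Lemma proj_min x z : X z -> enorm (x - Defs.proj X x) <= enorm (x - z).
Proof. by case: (proj_in_min x) => _; apply. Qed.

Lemma convex_segment x y (t : R) : 0 <= t <= 1 -> X x -> X y -> X (x + t *: (y - x)).
Proof.
move=> /andP[t0 t1] Xx Xy.
have t01 : Itv.spec (@Itv.num_sem R) (Itv.Real `[0%Z, 1%Z]) t.
  by rewrite /Itv.spec/= /Itv.num_sem/= num_real in_itv/= t0 t1.
have := X_convex (Itv.mk t01) (mem_set Xy) (mem_set Xx).
move=> /set_mem; congr (X _); rewrite /conv/=.
by rewrite scalerBr scalerBl scale1r addrCA.
Qed.


(** The angle characterisation of the projection, obtained by comparing [x]'s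
nearest point with nearby points of the segment towards [z]. *)
Lemma proj_variational x z : X z ->
  dotv (x - Defs.proj X x) (z - Defs.proj X x) <= 0.
Proof.
move=> Xz; set p := Defs.proj X x.
suff : 2 * dotv (x - p) (z - p) <= 0 by lra.
apply: (@le0_of_small_le _ _ (dotv (z - p) (z - p))) => t /andP[t0 t1].
have Xt : X (p + t *: (z - p)).
  by apply: convex_segment => //; [rewrite ltW|exact: proj_in].
have := proj_min x Xt; rewrite -/p -ler_sqr ?nnegrE ?enorm_ge0// !sqr_enorm.
rewrite opprD addrA.
move: (x - p) (z - p) => a b.
rewrite !dotvE (dotvC b a) => h.
rewrite -(ler_pM2l t0); lra.
Qed.

Lemma proj_nonexpansive x y :
  enorm (Defs.proj X x - Defs.proj X y) <= enorm (x - y).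
Proof.
have := proj_variational x (proj_in y); have := proj_variational y (proj_in x).
move: (Defs.proj X x) (Defs.proj X y) => p q h1 h2.
rewrite -ler_sqr ?nnegrE ?enorm_ge0// !sqr_enorm.
have := dotv_ge0 ((x - p) - (y - q)).
move: h1 h2; rewrite !dotvE.
rewrite (dotvC q p) (dotvC q y) (dotvC q x) (dotvC p y) (dotvC p x) (dotvC y x).
lra.
Qed.

Lemma proj_coord_continuous i :
  continuous (fun x => Defs.proj X x ord0 i : R).
Proof.
apply: (@enorm_lipschitz_continuous _ _ _ 1) => x y; rewrite mul1r.
apply: le_trans (proj_nonexpansive x y).
by have := coord_le_enorm (Defs.proj X x - Defs.proj X y) i; rewrite !mxE.
Qed.

Lemma dist_proj x : dist x X = enorm (x - Defs.proj X x).
Proof.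
apply/eqP; rewrite eq_le; apply/andP; split.
  apply: ge_inf; last by exists (Defs.proj X x) => //; exact: proj_in.
  by exists 0 => _ [z _ <-]; exact: enorm_ge0.
apply: lb_le_inf.
  by exists (enorm (x - Defs.proj X x)), (Defs.proj X x) => //; exact: proj_in.
by move=> _ [z Xz <-]; exact: proj_min.
Qed.

Lemma dist_le x z : X z -> dist x X <= enorm (x - z).
Proof. by move=> Xz; rewrite dist_proj proj_min. Qed.

Lemma dist_lip x y : dist x X <= dist y X + enorm (x - y).
Proof.
rewrite (dist_proj y); apply: le_trans (dist_le x (proj_in y)) _.
by rewrite [leRHS]addrC; apply: le_trans (enormD _ _); rewrite addrA subrK.
Qed.

Lemma dist_continuous : continuous (fun x => dist x X).
Proof.
apply: (@enorm_lipschitz_continuous _ _ _ 1) => x y; rewrite mul1r.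
have := dist_lip x y; have := dist_lip y x; rewrite (enormB x y) ler_norml; lra.
Qed.

(** The basic inequality of an extragradient step from [u]: [v] is the
extrapolated point, computed with [G], and [p] the new iterate, computed
with [H]. *)
Lemma extragradient_ineq (u v p G H xs : 'rV[R]_n) (g : R) :
    X xs -> v = Defs.proj X (u - g *: G) -> p = Defs.proj X (u - g *: H) ->
  enorm (p - xs) ^+ 2 <= enorm (u - xs) ^+ 2 - enorm (u - v) ^+ 2
    + g ^+ 2 * enorm (G - H) ^+ 2 - 2 * g * dotv H (v - xs).
Proof.
move=> Xxs vE pE.
have := proj_variational (u - g *: H) Xxs; rewrite -pE.
have := proj_variational (u - g *: G) (proj_in (u - g *: H)); rewrite -pE -vE.
move=> h1 h2.
(* [2 <p - v, g (G - H)>] is bounded by Young's inequality *)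
have := dotv_ge0 (p - v - g *: (G - H)).
rewrite !sqr_enorm; move: h1 h2; rewrite !dotvE.
rewrite ?(dotvC p u) ?(dotvC p v) ?(dotvC p xs) ?(dotvC p G) ?(dotvC p H).
rewrite ?(dotvC v u) ?(dotvC v xs) ?(dotvC v G) ?(dotvC v H).
rewrite ?(dotvC u xs) ?(dotvC u G) ?(dotvC u H) ?(dotvC xs G) ?(dotvC xs H) ?(dotvC G H).
lra.
Qed.

End projection.

(** * The solution set and one extragradient step *)

Section variational_inequality.
Context {R : realType} {n : nat}.
Variables (X : set 'rV[R]_n) (F : 'rV[R]_n -> 'rV[R]_n) (L : R).
Hypotheses (X_convex : convex_set X) (X_compact : compact X).
Hypothesis F_lip : forall x y, X x -> X y -> enorm (F x - F y) <= L * enorm (x - y).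
Hypothesis F_mono : monotone_over X F.

(** Minty's lemma: solutions can be tested against [F x] in place of [F xs]. *)
Lemma SVI_sol_minty :
  SVI_sol X F = [set xs | X xs /\ forall x, X x -> 0 <= dotv (x - xs) (F x)].
Proof.
apply/seteqP; split => xs [Xxs sol]; split => // x Xx.
  by have := F_mono Xx Xxs; have := sol _ Xx; rewrite dotvDr dotvNr; lra.
suff : - dotv (x - xs) (F xs) <= 0 by lra.
apply: (@le0_of_small_le _ _ (L * enorm (x - xs) ^+ 2)) => t /andP[t0 t1].
set y := xs + t *: (x - xs).
have Xy : X y by apply: convex_segment => //; rewrite (ltW t0).
have yxs : y - xs = t *: (x - xs) by rewrite /y addrAC subrr add0r.
have := sol _ Xy; rewrite yxs dotvZl pmulr_rge0// => h.
have := dotv_cauchy_schwarz (x - xs) (F y - F xs).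
have := F_lip Xy Xxs; rewrite yxs enormZ ?(ltW t0)// => lip.
have := ler_wpM2l (enorm_ge0 (x - xs)) lip.
rewrite [dotv _ (F y - _)]dotvDr dotvNr; lra.
Qed.

Lemma SVI_sol_convex : convex_set (SVI_sol X F).
Proof.
rewrite SVI_sol_minty => x y l /set_mem[Xx solx] /set_mem[Xy soly].
apply/mem_set; split; first by apply/set_mem/X_convex; exact: mem_set.
move=> z Xz; have := solx _ Xz; have := soly _ Xz.
have l0 : 0 <= l%:num by [].
have l1 : 0 <= 1 - l%:num by rewrite subr_ge0.
move=> sy sx; rewrite [z - _](_ : _ = l%:num *: (z - x) + (1 - l%:num) *: (z - y)).
  by rewrite dotvDl 2!dotvZl; apply: addr_ge0; exact: mulr_ge0.
rewrite /conv/= !scalerBr addrACA -scalerDl subrKC scale1r opprD; congr (_ + _).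
Qed.

Lemma SVI_sol_compact : compact (SVI_sol X F).
Proof.
apply: (subclosed_compact _ X_compact); last by move=> x [].
rewrite SVI_sol_minty (_ : mkset _ =
  X `&` \bigcap_(x in X) [set xs | 0 <= dotv (x - xs) (F x)]); last first.
  by apply/seteqP; split => xs [Xxs h]; split.
apply: closedI; first by apply: compact_closed => //; exact: norm_hausdorff.
apply: closed_bigI => x Xx.
have cf : continuous (fun xs : 'rV[R]_n => dotv (x - xs) (F x)).
  apply: (@enorm_lipschitz_continuous _ _ _ (enorm (F x))) => u v.
  have -> : dotv (x - u) (F x) - dotv (x - v) (F x) = dotv (v - u) (F x).
    by rewrite !dotvE; ring.
  have := dotv_cauchy_schwarz (v - u) (F x).
  have := dotv_cauchy_schwarz (u - v) (F x).
  rewrite (enormB v) -[u - v]opprB dotvNl ler_norml; lra.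
exact: (preimage_closed (fun y _ => cf y) (@closed_ge R 0)).
Qed.

End variational_inequality.

Section one_step.
Context {R : realType} {n : nat}.
Variables (X : set 'rV[R]_n) (F : 'rV[R]_n -> 'rV[R]_n) (L B U alpha : R).
Hypotheses (X_convex : convex_set X) (X_compact : compact X).
Hypothesis F_lip : forall x y, X x -> X y -> enorm (F x - F y) <= L * enorm (x - y).
Hypothesis F_bnd : forall x, X x -> enorm (F x) <= B / 2.
Hypothesis F_mono : monotone_over X F.
Hypothesis F_sharp : weakly_sharp X F alpha.
Hypothesis X_bnd : forall x, X x -> enorm x <= U.
Hypothesis alpha_ge0 : 0 <= alpha.
Hypothesis sol_neq0 : SVI_sol X F !=set0.

Let S := SVI_sol X F.
Let S_convex : convex_set S := SVI_sol_convex X_convex F_lip F_mono.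
Let S_compact : compact S := SVI_sol_compact X_convex X_compact F_lip F_mono.
Let X_neq0 : X !=set0. Proof. by case: sol_neq0 => x [Xx _]; exists x. Qed.

Lemma dist_sol_ge0 x : 0 <= dist x S.
Proof. by rewrite dist_proj// enorm_ge0. Qed.

Lemma dist_sol_le x : X x -> dist x S <= 2 * U.
Proof.
move=> Xx; rewrite dist_proj//.
have [XS _] := proj_in S_compact sol_neq0 x.
apply: le_trans (enormD _ _) _; rewrite enormN.
by have := X_bnd Xx; have := X_bnd XS; rewrite /S; lra.
Qed.

(** One extragradient step from [u] through [v] to [p], with operator errors
[w] and [w'] at [u] and [v]. *)
Lemma sqr_dist_extragradient (u v p w w' : 'rV[R]_n) (g : R) :
    0 <= g -> X u ->
    v = Defs.proj X (u - g *: (F u + w)) ->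
    p = Defs.proj X (u - g *: (F v + w')) ->
  dist p S ^+ 2 <= dist u S ^+ 2 - 2 * g * alpha * dist u S
    + g ^+ 2 * (alpha ^+ 2 + 3 * (B ^+ 2 + enorm w ^+ 2 + enorm w' ^+ 2))
    - 2 * g * dotv w' (v - Defs.proj S u).
Proof.
move=> g0 Xu vE pE.
set xs := Defs.proj S u.
have Sxs : S xs by exact: proj_in.
have [Xxs _] := Sxs.
have Xv : X v by rewrite vE; exact: proj_in.
have dp : dist p S ^+ 2 <= enorm (p - xs) ^+ 2.
  by rewrite ler_sqr ?nnegrE ?dist_sol_ge0 ?enorm_ge0//; exact: dist_le.
apply: le_trans dp _.
apply: le_trans (extragradient_ineq X_convex X_compact X_neq0 Xxs vE pE) _.
rewrite (_ : enorm (u - xs) = dist u S); last by rewrite dist_proj.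
have sharp : alpha * dist v S <= dotv (F v) (v - xs).
  apply: le_trans (F_sharp Xv Sxs) _; have := F_mono Xv Xxs.
  by rewrite dotvDr dotvNr dotvC (dotvC _ (v - xs)); lra.
have dv : dist u S <= dist v S + enorm (u - v) by exact: dist_lip.
have GH : enorm (F u + w - (F v + w')) ^+ 2 <=
    3 * (B ^+ 2 + enorm w ^+ 2 + enorm w' ^+ 2).
  rewrite opprD addrACA addrA -(enormN w').
  apply: le_trans (sqr_enormD3_le _ _ _) _.
  rewrite ler_pM2l// !lerD2r ler_sqr ?nnegrE ?enorm_ge0//.
    apply: le_trans (enormD _ _) _; rewrite enormN.
    by have := F_bnd Xu; have := F_bnd Xv; lra.
  by have := F_bnd Xu; have := enorm_ge0 (F u); lra.
have g2 : 0 <= g ^+ 2 := sqr_ge0 g.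
have {GH} := ler_wpM2l g2 GH.
have {dv} := ler_wpM2l (mulr_ge0 g0 alpha_ge0) dv.
have {sharp} := ler_wpM2l g0 sharp.
(* the move [u - v] costs [2 g alpha |u - v| <= g^2 alpha^2 + |u - v|^2] *)
have := sqr_ge0 (g * alpha - enorm (u - v)).
rewrite [dotv (F v + w') _]dotvDl.
lra.
Qed.

(** A crude bound on the variation of the squared distance, for the second-order
term of the Lyapunov step. *)
Lemma dist_extragradient_lip (u p H : 'rV[R]_n) (g : R) :
    0 <= g -> X u -> p = Defs.proj X (u - g *: H) ->
  (dist p S ^+ 2 - dist u S ^+ 2) ^+ 2 <= 16 * U ^+ 2 * g ^+ 2 * enorm H ^+ 2.
Proof.
move=> g0 Xu pE.
have Xp : X p by rewrite pE; exact: proj_in.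
have uE : u = Defs.proj X u.
  have := proj_min X_compact X_neq0 u Xu; rewrite subrr enorm0 => h.
  apply/eqP; rewrite -subr_eq0; apply/eqP/enorm_eq0/eqP.
  by rewrite eq_le h enorm_ge0.
have pu : enorm (p - u) <= g * enorm H.
  rewrite pE [X in _ - X]uE.
  apply: le_trans (proj_nonexpansive X_convex X_compact X_neq0 _ _) _.
  by rewrite addrAC subrr add0r enormN enormZ.
have d1 := dist_lip S_compact sol_neq0 p u.
have d2 := dist_lip S_compact sol_neq0 u p.
rewrite (enormB u) in d2.
have dd : (dist p S - dist u S) ^+ 2 <= (g * enorm H) ^+ 2.
  rewrite -ler_sqrt ?sqr_ge0// !sqrtr_sqr [leRHS]ger0_norm ?mulr_ge0 ?enorm_ge0//.
  by rewrite ler_norml; apply/andP; split; rewrite /S; lra.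
have ds : (dist p S + dist u S) ^+ 2 <= 16 * U ^+ 2.
  rewrite (_ : 16 * _ = (4 * U) ^+ 2); last by ring.
  have := dist_sol_le Xp; have := dist_sol_le Xu.
  have := dist_sol_ge0 p; have := dist_sol_ge0 u.
  by move=> *; rewrite ler_sqr ?nnegrE; lra.
rewrite (_ : _ - _ = (dist p S - dist u S) * (dist p S + dist u S)); last by ring.
rewrite exprMn [leRHS](_ : _ = (g * enorm H) ^+ 2 * (16 * U ^+ 2)); last by ring.
by apply: ler_pM => //; exact: sqr_ge0.
Qed.

End one_step.

(** * Scalar inequalities *)

Section scalar_lemmas.
Context {R : realType}.

Lemma expR_le_quadratic (K y : R) : y <= K ->
  expR y <= 1 + y + (2 + 4 * expR K) * y ^+ 2.
Proof.
move=> yK; have e0 := expR_gt0 K; have y2 := sqr_ge0 y.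
have ey2 : 0 <= expR K * y ^+ 2 by rewrite mulr_ge0// ltW.
have [yh|yh] := lerP y 2^-1.
  have h := expR_ge1Dx (- y); rewrite expRN in h.
  have y1 : 0 < 1 - y by lra.
  have : expR y <= (1 - y)^-1.
    by rewrite -[leLHS]invrK lef_pV2 ?posrE ?invr_gt0 ?expR_gt0.
  move=> /le_trans; apply.
  rewrite -[leLHS]mul1r ler_pdivrMr//.
  suff : 0 <= (1 - 2 * y) * y ^+ 2 + 4 * (1 - y) * (expR K * y ^+ 2) by lra.
  apply: addr_ge0; first by apply: mulr_ge0 => //; lra.
  by apply: mulr_ge0 => //; lra.
have : expR y <= expR K by rewrite ler_expR.
move=> /le_trans; apply.
have : 0 <= (4 * y ^+ 2 - 1) * expR K.
  apply: mulr_ge0; last exact: ltW.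
  have : 2^-1 * 2^-1 <= y * y by apply: ler_pM; rewrite ?invr_ge0// ltW.
  rewrite -expr2; lra.
lra.
Qed.

(** Any constant larger than 1 in place of [3 / 2] would give the rate [1 / k]; with
[3 / 2] the condition on [M] reads [2 * q <= M].  At [k = 1] the factor
[1 - 3 / (2 k)] is negative, and the sign of [a 1] is used instead. *)
Lemma recursion_rate (a : nat -> R) (q M : R) :
    (forall k, 0 <= a k) ->
    (forall k, (0 < k)%N -> a k.+1 <= a k - 3 / 2 * (a k / k%:R) + q / k%:R ^+ 2) ->
    a 1%N <= M -> 2 * q <= M ->
  forall k, (0 < k)%N -> a k <= M / k%:R.
Proof.
move=> a0 rec a1 qM [//|k] _; elim: k => [|k ih]; first by rewrite divr1.
apply: le_trans (rec _ _) _ => //.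
have M0 : 0 <= M by rewrite (le_trans (a0 1%N)).
set r : R := k.+1%:R in ih *.
have r1 : 1 <= r by rewrite ler1n.
rewrite (_ : k.+2%:R = r + 1); last by rewrite natr1.
case: k => [|k] in r ih r1 *.
  rewrite /r !divr1 expr1n divr1.
  have -> : M / (1%:R + 1) = M / 2 by rewrite -[2]natr1.
  have := a0 1%N; lra.
have r2 : 2 <= r by rewrite ler_nat.
have r0 : 0 < r by lra.
have -> : a k.+2 - 3 / 2 * (a k.+2 / r) + q / r ^+ 2 =
    a k.+2 * (1 - 3 / 2 / r) + q / r ^+ 2 by ring.
have c0 : 0 <= 1 - 3 / 2 / r by rewrite subr_ge0 ler_pdivrMr//; lra.
have qM' : q / r ^+ 2 <= M / 2 / r ^+ 2.
  by rewrite ler_wpM2r ?invr_ge0 ?sqr_ge0//; lra.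
apply: le_trans (lerD (ler_wpM2r c0 ih) qM') _.
rewrite -subr_ge0.
have -> : M / (r + 1) - (M / r * (1 - 3 / 2 / r) + M / 2 / r ^+ 2) =
   M / (r ^+ 2 * (r + 1)).
  by field; rewrite !gt_eqF//; lra.
by rewrite divr_ge0// mulr_ge0 ?sqr_ge0//; lra.
Qed.

End scalar_lemmas.

(** * Borel measurability of vector-valued functions *)

Section borel_vectors.
Context {R : realType} {n : nat} {d : measure_display} {T : measurableType d}.

Lemma borelV_open_measurable (A : set 'rV[R]_n) :
  open A -> measurable (A : set (borelV R n)).
Proof. by move=> oA; exact: sub_sigma_algebra. Qed.

Lemma borelV_closed_measurable (A : set 'rV[R]_n) :
  closed A -> measurable (A : set (borelV R n)).
Proof.
move=> cA; rewrite -[A]setCK; apply: measurableC.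
by apply: borelV_open_measurable; exact: closed_openC.
Qed.

Lemma measurable_continuous_borelV (g : 'rV[R]_n -> R) (f : T -> 'rV[R]_n) :
  continuous g -> measurable_fun setT (f : T -> borelV R n) ->
  measurable_fun setT (g \o f).
Proof.
move=> cg mf; apply: (measurability _ (measurable_realfun.RGenOpens.measurableE R)).
move=> _ [_ [a [b ->]] <-]; rewrite setTI comp_preimage.
have := mf measurableT (g @^-1` `]a, b[%classic : set (borelV R n)).
rewrite setTI; apply; apply: borelV_open_measurable.
by apply: open_comp => [x _|]; [exact: cg|exact: interval_open].
Qed.

Lemma measurable_coord (f : T -> 'rV[R]_n) i :
  measurable_fun setT (f : T -> borelV R n) ->
  measurable_fun setT (fun t => f t ord0 i).
Proof.
apply: (@measurable_continuous_borelV (fun u => u ord0 i)).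
exact: coord_continuous.
Qed.

(** Every open set of ['rV[R]_n] is a countable union of cubes with rational
centre and radius [m.+1^-1]. *)
Lemma open_bigcup_rat_cubes (A : set 'rV[R]_n) : open A ->
  A = \bigcup_(q in [set q : 'rV[rat]_n * nat |
        ball (map_mx ratr q.1 : 'rV[R]_n) q.2.+1%:R^-1 `<=` A])
      ball (map_mx ratr q.1 : 'rV[R]_n) q.2.+1%:R^-1.
Proof.
move=> oA; apply/seteqP; split; last by move=> x [q /= qA]; exact: qA.
move=> x Ax; have /nbhs_ballP[e /= e0 xeA] : nbhs x A by exact: open_nbhs_nbhs.
have e20 : 0 < e / 2 by rewrite divr_gt0.
have [m _ /(_ m (leqnn _)) me] := near_infty_natSinv_lt (PosNum e20).
have m0 : 0 < m.+1%:R^-1 :> R by rewrite invr_gt0.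
have [q xq] : {q : 'rV[rat]_n | forall i, `|x ord0 i - ratr (q ord0 i)| < m.+1%:R^-1}.
  have h i : exists r : rat, `|x ord0 i - ratr r| < m.+1%:R^-1.
    have /rat_in_itvoo[r] : x ord0 i < x ord0 i + m.+1%:R^-1 by rewrite ltrDl.
    rewrite in_itv/= => /andP[r1 r2]; exists r.
    by rewrite ltr_norml; move: (_^-1 : R) r1 r2 m0 => c r1 r2 m0; lra.
  exists (\row_i projT1 (cid (h i))) => i; rewrite mxE.
  by case: cid.
exists (q, m) => /=.
  move=> y [_ qy]; apply: xeA; split => // j i.
  rewrite (ord1 j); have := qy ord0 i; have := xq i.
  rewrite /ball/= mxE => h1 h2.
  rewrite -(subrKA (ratr (q ord0 i))); apply: le_lt_trans (ler_normD _ _) _.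
  by rewrite (splitr e) ltrD//; [exact: lt_trans h1 me|exact: lt_trans h2 me].
split => // j i; rewrite (ord1 j) mxE /ball/= distrC; exact: xq.
Qed.

Lemma measurable_borelV (f : T -> 'rV[R]_n) :
  (forall i, measurable_fun setT (fun t => f t ord0 i)) ->
  measurable_fun setT (f : T -> borelV R n).
Proof.
move=> mf; apply: (@measurability _ _ _ (borelV R n) setT f open) => //.
move=> _ [A oA <-]; rewrite setTI (open_bigcup_rat_cubes oA) bigcup_mkcond.
rewrite preimage_bigcup; apply: countable_bigcupT_measurable => // -[q m].
case: ifPn => _; last by rewrite preimage_set0.
rewrite (_ : _ @^-1` _ = \bigcap_(i in [set: 'I_n])
   (fun t => f t ord0 i) @^-1` (ball (ratr (q ord0 i) : R) m.+1%:R^-1)).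
  apply: fin_bigcap_measurable => // i _; rewrite -[_ @^-1` _]setTI.
  by apply: mf => //; apply: measurable_realfun.open_measurable; exact: ball_open.
apply/seteqP; split => t /=.
  by move=> [_ h] i _; have := h ord0 i; rewrite mxE.
move=> h; split; first by rewrite invr_gt0.
by move=> j i; rewrite (ord1 j) mxE; exact: h.
Qed.

End borel_vectors.

(** * Conditional moments *)

Section conditional_mean.
Context {R : realType} {dT : measure_display} {T : measurableType dT}.
Variables (P : probability T R).

Lemma bounded_integrable (f : T -> R) (K : R) :
  measurable_fun setT f -> (forall t, `|f t| <= K) -> P.-integrable setT (EFin \o f).
Proof.
move=> mf fK; apply: measurable_bounded_integrable => //.
  by rewrite -[X in (X < _)%E]/(P setT) probability_setT ltry.
by exists K; split; [exact: num_real|move=> M KM t _; exact: le_trans (fK t) (ltW KM)].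
Qed.

Lemma integrable_addr (f g : T -> R) :
  P.-integrable setT (EFin \o f) -> P.-integrable setT (EFin \o g) ->
  P.-integrable setT (EFin \o (fun t => f t + g t)).
Proof.
move=> fi gi.
by apply: (@eq_integrable _ _ _ _ _ measurableT _ _ _ (integrableD measurableT fi gi)).
Qed.

Lemma integrable_mull (f : T -> R) (k : R) :
  P.-integrable setT (EFin \o f) ->
  P.-integrable setT (EFin \o (fun t => k * f t)).
Proof.
move=> fi.
by apply: (@eq_integrable _ _ _ _ _ measurableT _ _ _ (integrableZl measurableT k fi)).
Qed.

Lemma integrable_big_sum (I : Type) (s : seq I) (f : I -> T -> R) :
  (forall i, P.-integrable setT (EFin \o f i)) ->
  P.-integrable setT (EFin \o (fun t => \sum_(i <- s) f i t)).
Proof.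
move=> fi; apply: (@eq_integrable _ _ _ _ _ measurableT _ _ _
  (integrable_sum measurableT s (P := xpredT) (fun i _ => fi i))).
by move=> t _ /=; rewrite sumEFin.
Qed.

Lemma Rintegral_big_sum (I : Type) (s : seq I) (f : I -> T -> R) :
  (forall i, P.-integrable setT (EFin \o f i)) ->
  \int[P]_t (\sum_(i <- s) f i t) = \sum_(i <- s) \int[P]_t f i t.
Proof.
move=> fi; elim: s => [|i s ih].
  by under eq_Rintegral do rewrite big_nil; rewrite big_nil Rintegral_cst// mul0r.
rewrite big_cons -ih -RintegralD//; last exact: integrable_big_sum.
by apply: eq_Rintegral => t _; rewrite big_cons.
Qed.

Lemma integrable_bounded_mul (f g : T -> R) (K : R) :
  measurable_fun setT f -> (forall t, `|f t| <= K) ->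
  P.-integrable setT (EFin \o g) ->
  P.-integrable setT (EFin \o (fun t => f t * g t)).
Proof.
move=> mf fK ig.
have mg : measurable_fun setT g by apply/measurable_EFinP; exact: measurable_int ig.
apply: (le_integrable measurableT _ _ (integrable_mull K ig)).
- by apply/measurable_EFinP; exact: measurable_funM.
- move=> t _ /=; rewrite lee_fin !normrM ler_wpM2r//.
  exact: le_trans (fK t) (ler_norm K).
Qed.

Variable G : set (set T).
Hypothesis G_meas : <<s G >> `<=` @measurable dT T.

Lemma measurable_sub_sigma d' (S : measurableType d') (f : T -> S) :
  measurable_fun setT (f : g_sigma_algebraType G -> S) -> measurable_fun setT f.
Proof. by move=> mf _ A mA; apply: G_meas; exact: mf. Qed.

Lemma Rintegral_indic_mul (E : set T) (W : T -> R) :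
  \int[P]_t (\1_E t * W t) = \int[P]_(t in E) W t.
Proof.
rewrite [RHS]Rintegral_mkcond; apply: eq_Rintegral => t _.
by rewrite patchE indicE; case: ifP => _; rewrite ?mul1r ?mul0r.
Qed.

(** A centered [W] is orthogonal to every bounded [Y] that is measurable for the
sub-sigma-algebra: [Y] is approximated uniformly by [truncn (m.+1 * Y) / m.+1],
a combination of indicators of events of that sub-sigma-algebra. *)
Lemma Rintegral_mul_centered_ge0 (W Y : T -> R) (K : R) :
    P.-integrable setT (EFin \o W) ->
    (forall E, <<s G >> E -> \int[P]_(t in E) W t = 0) ->
    measurable_fun setT (Y : g_sigma_algebraType G -> R) ->
    (forall t, 0 <= Y t <= K) ->
  \int[P]_t (Y t * W t) = 0.
Proof.
move=> iW W0 mY YK.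
have mY' : measurable_fun setT Y := measurable_sub_sigma mY.
have mW : measurable_fun setT W by apply/measurable_EFinP; exact: measurable_int iW.
have inW : P.-integrable setT (EFin \o (fun t => `|W t|)).
  exact: (@integrable_norm _ _ _ _ _ W).
suff h (m : nat) : `|\int[P]_t (Y t * W t)| <= m.+1%:R^-1 * \int[P]_t `|W t|.
  apply/eqP; rewrite -normr_le0.
  apply/ler_addgt0Pr => e e0; rewrite add0r.
  set I := \int[P]_t `|W t| in h.
  have I0 : 0 <= I by exact: Rintegral_ge0.
  have e1 : 0 < e / (I + 1) by rewrite divr_gt0// ltr_wpDl.
  have [m _ /(_ m (leqnn _)) /= me] := near_infty_natSinv_lt (PosNum e1).
  apply: le_trans (h m) _; apply: le_trans (ler_wpM2r I0 (ltW me)) _.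
  by rewrite mulrAC ler_pdivrMr ?ltr_wpDl// ler_pM2l// lerDl.
set N := (Num.truncn (m.+1%:R * K)).+1.
pose E j := [set t | j%:R <= m.+1%:R * Y t < j.+1%:R].
have mE j : <<s G >> (E j).
  have mYm : measurable_fun setT (fun t : g_sigma_algebraType G => m.+1%:R * Y t).
    by apply: measurable_funM => //; exact: measurable_cst.
  have := mYm.
  move=> /(_ measurableT (`[j%:R, j.+1%:R[%classic) (measurable_itv _)).
  by rewrite setTI; congr (_ _); apply/seteqP; split => t; rewrite /= in_itv.
have mE' j : measurable (E j) by exact: G_meas.
pose Ym t : R := \sum_(j < N) (j%:R / m.+1%:R) * \1_(E j) t.
have YmE t : Ym t = (Num.truncn (m.+1%:R * Y t))%:R / m.+1%:R.
  have /andP[Y0 Yk] := YK t.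
  have mY0 : 0 <= m.+1%:R * Y t by rewrite mulr_ge0.
  have cN : (Num.truncn (m.+1%:R * Y t) < N)%N.
    by rewrite ltnS le_truncn// ler_pM2l.
  rewrite /Ym (bigD1 (Ordinal cN))//= big1 ?addr0 => [|j jc].
    by rewrite indicE mem_set ?mulr1//=; apply: truncn_itv.
  rewrite indicE memNset ?mulr0//= => jE; move/negP: jc; apply.
  by apply/eqP/val_inj => /=; apply/esym/truncn_def.
have YYm t : `|Y t - Ym t| <= m.+1%:R^-1.
  have /andP[Y0 Yk] := YK t.
  have mY0 : 0 <= m.+1%:R * Y t by rewrite mulr_ge0.
  rewrite YmE; have /andP[] := truncn_itv mY0.
  set c := Num.truncn _; rewrite -(natr1 c) => c1 c2.
  rewrite ger0_norm.
    rewrite lerBlDr [leRHS](_ : _ = (c%:R + 1) / m.+1%:R); last first.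
      by rewrite mulrDl mul1r addrC.
    by rewrite ler_pdivlMr// mulrC ltW.
  by rewrite subr_ge0 ler_pdivrMr// mulrC.
have iE j : P.-integrable setT (EFin \o (fun t => \1_(E j) t * W t)).
  apply: (@integrable_bounded_mul _ _ 1) => // t.
  by rewrite indicE; case: (_ \in _); rewrite ?normr1 ?normr0.
have mYm : measurable_fun setT Ym.
  by apply: measurable_sum => j; apply: measurable_funM.
have iYmW : P.-integrable setT (EFin \o (fun t => Ym t * W t)).
  have YmB t : `|Ym t| <= K + m.+1%:R^-1.
    have := YYm t; have := YK t; rewrite !ler_norml; move: (m.+1%:R^-1) => c; lra.
  exact: integrable_bounded_mul mYm YmB iW.
have iYW : P.-integrable setT (EFin \o (fun t => Y t * W t)).
  apply: (@integrable_bounded_mul _ _ K) => // t.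
  by have := YK t; rewrite ler_norml; lra.
have Ym0 : \int[P]_t (Ym t * W t) = 0.
  rewrite (_ : (fun t => _) = fun t =>
    \sum_(j < N) (j%:R / m.+1%:R) * (\1_(E j) t * W t)); last first.
    by apply/funext => t; rewrite mulr_suml; apply: eq_bigr => j _; rewrite mulrA.
  rewrite Rintegral_big_sum => [|j]; last exact: integrable_mull.
  by apply: big1 => j _; rewrite RintegralZl// Rintegral_indic_mul W0 ?mulr0.
have -> : \int[P]_t (Y t * W t) = \int[P]_t ((Y t - Ym t) * W t).
  rewrite -[LHS]subr0 -Ym0 -RintegralB//; apply: eq_Rintegral => t _.
  by rewrite mulrBl.
have iB : P.-integrable setT (EFin \o (fun t => (Y t - Ym t) * W t)).
  by apply: (integrable_bounded_mul _ YYm) => //; exact: measurable_funB.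
apply: le_trans (le_normr_Rintegral _ iB) _ => //.
rewrite -RintegralZl//; apply: le_Rintegral => //.
- exact: (@integrable_norm _ _ _ _ _ (fun t => (Y t - Ym t) * W t)).
- exact: integrable_mull.
- by move=> t _; rewrite normrM ler_wpM2r.
Qed.

Lemma Rintegral_mul_centered (W Y : T -> R) (K : R) :
    P.-integrable setT (EFin \o W) ->
    (forall E, <<s G >> E -> \int[P]_(t in E) W t = 0) ->
    measurable_fun setT (Y : g_sigma_algebraType G -> R) ->
    (forall t, `|Y t| <= K) ->
  \int[P]_t (Y t * W t) = 0.
Proof.
move=> iW W0 mY YK.
have mYK : measurable_fun setT (fun t : g_sigma_algebraType G => Y t + K).
  by apply: measurable_funD => //; exact: measurable_cst.
have mY' := measurable_sub_sigma mY.
have YK2 t : 0 <= Y t + K <= 2 * K by have := YK t; rewrite ler_norml; lra.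
have := Rintegral_mul_centered_ge0 iW W0 mYK YK2.
have iYW := integrable_bounded_mul mY' YK iW.
under eq_Rintegral do rewrite mulrDl.
rewrite RintegralD//; last exact: integrable_mull.
rewrite RintegralZl// (W0 setT) ?mulr0 ?addr0//.
exact: (@measurableT _ (g_sigma_algebraType G)).
Qed.

Lemma cond_mean_zero_Rintegral n (W : T -> 'rV[R]_n) i :
  cond_mean_zero P <<s G >> W ->
  P.-integrable setT (EFin \o (fun t => W t ord0 i)) /\
  forall E, <<s G >> E -> \int[P]_(t in E) W t ord0 i = 0.
Proof.
move=> /(_ i)[Z [iW iZ _ WZ] Z0]; split => // E GE.
rewrite /Rintegral -WZ// (ae_eq_integral (cst 0%E))//=.
- by rewrite integral0.
- exact: G_meas.
- apply/measurable_EFinP; apply: measurable_funTS; apply/measurable_EFinP.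
  exact: measurable_int iZ.
- by apply: filterS Z0 => t /= -> _.
Qed.

Lemma cond_mean_zero_orthogonal n (W Y : T -> 'rV[R]_n) (K : R) :
    cond_mean_zero P <<s G >> W ->
    (forall i, measurable_fun setT (fun t : g_sigma_algebraType G => Y t ord0 i)) ->
    (forall t i, `|Y t ord0 i| <= K) ->
  P.-integrable setT (EFin \o (fun t => dotv (Y t) (W t))) /\
  \int[P]_t dotv (Y t) (W t) = 0.
Proof.
move=> W0 mY YK.
have iYW i : P.-integrable setT (EFin \o (fun t => Y t ord0 i * W t ord0 i)).
  apply: (@integrable_bounded_mul _ _ K) => //; first exact: measurable_sub_sigma.
  by case: (cond_mean_zero_Rintegral i W0).
split; first exact: integrable_big_sum.
rewrite Rintegral_big_sum//; apply: big1 => i _.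
have [iW W0i] := cond_mean_zero_Rintegral i W0.
by apply: (@Rintegral_mul_centered _ _ K).
Qed.

Lemma cond_sqnorm_le_Rintegral n (W : T -> 'rV[R]_n) (nu : R) :
  cond_sqnorm_le P <<s G >> W nu ->
  P.-integrable setT (EFin \o (fun t => enorm (W t) ^+ 2)) /\
  \int[P]_t (enorm (W t) ^+ 2) <= nu ^+ 2.
Proof.
move=> [Z [iW iZ _ WZ] Znu]; split => //.
have G1 : <<s G >> setT by exact: (@measurableT _ (g_sigma_algebraType G)).
rewrite /Rintegral -WZ//.
have : (\int[P]_(t in setT) (Z t)%:E <= \int[P]_(t in setT) (nu ^+ 2)%:E)%E.
  have mZ : measurable_fun setT Z by apply/measurable_EFinP; exact: measurable_int iZ.
  have mZ' : measurable_fun setT (fun t => Num.min (Z t) (nu ^+ 2)).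
    by apply: measurable_minr => //; exact: measurable_cst.
  have inu : P.-integrable setT (EFin \o (fun _ : T => nu ^+ 2)).
    by apply: (@bounded_integrable _ `|nu ^+ 2|) => //; exact: measurable_cst.
  (* truncating [Z] at [nu ^+ 2] makes the almost sure bound pointwise *)
  rewrite (ae_eq_integral (fun t => (Num.min (Z t) (nu ^+ 2))%:E))//.
  - apply: le_integral => //.
      apply: (le_integrable measurableT _ _ (integrable_addr (integrable_norm iZ) inu)).
        exact/measurable_EFinP.
      move=> t _ /=; rewrite lee_fin [leRHS]ger0_norm ?addr_ge0 ?sqr_ge0//.
      have := sqr_ge0 nu; rewrite /Num.min; case: ifPn => _ n0.
        by rewrite lerDl.
      by rewrite ger0_norm// lerDr.
    by move=> t _; rewrite lee_fin ge_min lexx orbT.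
  - exact/measurable_EFinP.
  - exact/measurable_EFinP.
  - by apply: filterS Znu => t Zt _; rewrite min_l.
rewrite integral_cst// -[X in (_ * X)%E]/(P setT) probability_setT mule1.
have : (\int[P]_(t in setT) (Z t)%:E)%E \is a fin_num by exact: integrable_fin_num.
by move=> /fineK {1}<-; rewrite lee_fin.
Qed.

End conditional_mean.

(** * Measurability of the iterates *)

Section iterates.
Context {R : realType} {n d : nat} {dO : measure_display} {Omega : measurableType dO}.
Variables (X : set 'rV[R]_n) (xi : Omega -> 'rV[R]_d).
Variables (Fs : 'rV[R]_n -> 'rV[R]_d -> 'rV[R]_n) (F : 'rV[R]_n -> 'rV[R]_n).
Hypotheses (X_convex : convex_set X) (X_compact : compact X) (X_neq0 : X !=set0).
Hypothesis xi_meas : measurable_fun setT (xi : Omega -> borelV R d).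
Hypothesis Fs_meas : measurable_fun ((X : set (borelV R n)) `*` [set: borelV R d])
     (fun p : borelV R n * borelV R d => (Fs p.1 p.2 : borelV R n)).

Let X_closed : closed X.
Proof. by apply: compact_closed => //; exact: norm_hausdorff. Qed.

Lemma measurable_proj dT (T : measurableType dT) (f : T -> 'rV[R]_n) :
  measurable_fun setT (f : T -> borelV R n) ->
  measurable_fun setT ((fun t => Defs.proj X (f t)) : T -> borelV R n).
Proof.
move=> mf; apply: measurable_borelV => i.
exact: (measurable_continuous_borelV
  (@proj_coord_continuous _ _ _ X_convex X_compact X_neq0 i) mf).
Qed.

Lemma measurable_projected_step dT (T : measurableType dT)
    (x y : T -> 'rV[R]_n) (o : T -> Omega) (g : R) :
  measurable_fun setT (x : T -> borelV R n) ->
  measurable_fun setT (y : T -> borelV R n) -> (forall t, X (y t)) ->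
  measurable_fun setT o ->
  measurable_fun setT
    ((fun t => Defs.proj X (x t - g *: (F (y t) + noise F Fs xi y o t)))
      : T -> borelV R n).
Proof.
move=> mx my Xy mo; apply: measurable_proj; apply: measurable_borelV => i.
have mF : measurable_fun setT ((fun t => Fs (y t) (xi (o t))) : T -> borelV R n).
  have mp : measurable_fun setT
      (fun t => (y t, xi (o t)) : borelV R n * borelV R d).
    by apply: measurable_fun_pair => //; exact: (measurableT_comp xi_meas mo).
  apply: (measurable_comp _ _ Fs_meas mp).
    by apply: measurableX => //; exact: borelV_closed_measurable.
  by move=> _ [t _ <-]; split => //=; exact: Xy.
(* adding the noise to [F] gives back the sample [Fs] *)
rewrite (_ : (fun t => _) = fun t => x t ord0 i - g * Fs (y t) (xi (o t)) ord0 i).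
  apply: measurable_funB; first exact: measurable_coord.
  by apply: measurable_funM; [exact: measurable_cst|exact: measurable_coord].
by apply/funext => t; rewrite /noise [F _ + _]addrC subrK !mxE.
Qed.

Variables (dT : measure_display) (T : measurableType dT) (om omh : nat -> T -> Omega).
Variables (gamma : nat -> R) (x xh : nat -> T -> 'rV[R]_n).
Hypothesis om_meas : forall k, measurable_fun setT (om k).
Hypothesis omh_meas : forall k, measurable_fun setT (omh k).
Hypothesis x0_meas : measurable_fun setT (x 0%N : T -> borelV R n).
Hypothesis x0_in : forall t, X (x 0%N t).
Hypothesis esa : is_ESA X F Fs xi gamma om omh x xh.

Lemma iterate_in k t : X (x k t).
Proof.
case: k => [//|k]; have [_ ->] := esa k t; exact: proj_in.
Qed.

Lemma half_iterate_in k t : X (xh k t).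
Proof. have [-> _] := esa k t; exact: proj_in. Qed.

(** [history] and [half_history] are by definition the sigma-algebras generated
by the next two families; naming the families gives access to the measurable
types carrying these sigma-algebras. *)
Definition history_gen k : set (set T) :=
  preimage_set_system setT (x 0%N : T -> borelV R n) measurable `|`
      \bigcup_(j in `I_k) (preimage_set_system setT (om j) measurable `|`
                           preimage_set_system setT (omh j) measurable).

Definition half_history_gen k : set (set T) :=
  history (x 0%N) om omh k `|` preimage_set_system setT (om k) measurable.

Lemma history_measurable k : <<s history_gen k >> `<=` @measurable dT T.
Proof.
apply: smallest_sub; first exact: sigma_algebra_measurable.
move=> A [[B mB <-]|[j _ [[B mB <-]|[B mB <-]]]].
- exact: x0_meas.
- exact: om_meas.
- exact: omh_meas.
Qed.

Lemma half_history_measurable k : <<s half_history_gen k >> `<=` @measurable dT T.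
Proof.
apply: smallest_sub; first exact: sigma_algebra_measurable.
move=> A [|[B mB <-]]; first exact: history_measurable.
exact: om_meas.
Qed.

Lemma history_sub_half k : <<s history_gen k >> `<=` <<s half_history_gen k >>.
Proof. by move=> A hA; apply: sub_sigma_algebra; left. Qed.

Lemma half_history_sub k : <<s half_history_gen k >> `<=` <<s history_gen k.+1 >>.
Proof.
apply: smallest_sub; first exact: smallest_sigma_algebra.
move=> A [|omA].
  apply: sub_smallest2r; first exact: smallest_sigma_algebra.
  move=> B [?|[j /= jk jB]]; [by left|right].
  by exists j => //=; rewrite ltnS ltnW.
by apply: sub_sigma_algebra; right; exists k => //=; left.
Qed.

Lemma measurable_finer d' (S : measurableType d') (G1 G2 : set (set T)) (f : T -> S) :
  <<s G1 >> `<=` <<s G2 >> ->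
  measurable_fun setT (f : g_sigma_algebraType G1 -> S) ->
  measurable_fun setT (f : g_sigma_algebraType G2 -> S).
Proof. by move=> G12 mf _ A mA; apply: G12; exact: mf. Qed.

Lemma iterate_half_measurable k :
  measurable_fun setT (x k : g_sigma_algebraType (history_gen k) -> borelV R n) ->
  measurable_fun setT (xh k : g_sigma_algebraType (half_history_gen k) -> borelV R n).
Proof.
move=> mx.
have mx' := measurable_finer (@history_sub_half k) mx.
rewrite (_ : xh k = fun t => Defs.proj X (x k t -
  gamma k *: (F (x k t) + noise F Fs xi (x k) (om k) t))); last first.
  by apply/funext => t; have [-> _] := esa k t.
apply: measurable_projected_step => //; first exact: iterate_in.
by move=> _ A mA; apply: sub_sigma_algebra; right; exists A.
Qed.

Lemma iterate_measurable k :
  measurable_fun setT (x k : g_sigma_algebraType (history_gen k) -> borelV R n).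
Proof.
elim: k => [|k ih].
  by move=> _ A mA; apply: sub_sigma_algebra; left; exists A.
have mxh := measurable_finer (@half_history_sub k) (iterate_half_measurable ih).
have mx := measurable_finer (subset_trans (@history_sub_half k) (@half_history_sub k)) ih.
rewrite (_ : x k.+1 = fun t => Defs.proj X (x k t -
  gamma k *: (F (xh k t) + noise F Fs xi (xh k) (omh k) t))); last first.
  by apply/funext => t; have [_ ->] := esa k t.
apply: measurable_projected_step => //; first exact: half_iterate_in.
by move=> _ A mA; apply: sub_sigma_algebra; right; exists k => //=; right; exists A.
Qed.

Lemma half_iterate_measurable k :
  measurable_fun setT (xh k : g_sigma_algebraType (half_history_gen k) -> borelV R n).
Proof. exact: iterate_half_measurable (@iterate_measurable k). Qed.

End iterates.

(** * The expected Lyapunov step *)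

Section rate_constant.
Context {R : realType}.
Variables (B nu alpha U : R).

(** The factor of [gamma k ^+ 2] in the expected step, for the Lyapunov function
[b |-> expR (lam * b) - 1] on [[0, 4 * U ^+ 2]]. *)
Definition exp_rate_constant (lam : R) : R :=
  lam * expR (lam * (4 * U ^+ 2)) * (alpha ^+ 2 + 3 * B ^+ 2 + 6 * nu ^+ 2)
  + expR (lam * (4 * U ^+ 2)) * (2 + 4 * expR (lam * (4 * U ^+ 2))) * lam ^+ 2
    * (8 * U ^+ 2 * B ^+ 2 + 32 * U ^+ 2 * nu ^+ 2).

Lemma exp_rate_constant_ge0 lam : 0 <= lam -> 0 <= exp_rate_constant lam.
Proof.
move=> lam0; rewrite /exp_rate_constant; set e1 := expR _.
have e10 : 0 <= e1 by exact: expR_ge0.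
have s1 : 0 <= alpha ^+ 2 + 3 * B ^+ 2 + 6 * nu ^+ 2.
  by have := sqr_ge0 alpha; have := sqr_ge0 B; have := sqr_ge0 nu; lra.
have s2 : 0 <= 8 * U ^+ 2 * B ^+ 2 + 32 * U ^+ 2 * nu ^+ 2.
  by apply: addr_ge0; rewrite -mulrA mulr_ge0// mulr_ge0 ?sqr_ge0.
have e2 : 0 <= 2 + 4 * e1 by lra.
by apply: addr_ge0; rewrite !mulr_ge0 ?sqr_ge0.
Qed.

End rate_constant.

Section expected_recursion.
Context {R : realType} {n d : nat} {dO : measure_display} {Omega : measurableType dO}.
Variables (X : set 'rV[R]_n) (xi : Omega -> 'rV[R]_d).
Variables (Fs : 'rV[R]_n -> 'rV[R]_d -> 'rV[R]_n) (F : 'rV[R]_n -> 'rV[R]_n).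
Variables (L B nu alpha U : R).
Hypotheses (X_convex : convex_set X) (X_compact : compact X).
Hypothesis xi_meas : measurable_fun setT (xi : Omega -> borelV R d).
Hypothesis Fs_meas : measurable_fun ((X : set (borelV R n)) `*` [set: borelV R d])
     (fun p : borelV R n * borelV R d => (Fs p.1 p.2 : borelV R n)).
Hypothesis alpha_gt0 : 0 < alpha.
Hypothesis F_lip : forall x y, X x -> X y -> enorm (F x - F y) <= L * enorm (x - y).
Hypothesis F_bnd : forall x, X x -> enorm (F x) <= B / 2.
Hypothesis F_mono : monotone_over X F.
Hypothesis F_sharp : weakly_sharp X F alpha.
Hypothesis X_bnd : forall x, X x -> enorm x <= U.
Hypothesis sol_neq0 : SVI_sol X F !=set0.

Variables (dT : measure_display) (T : measurableType dT) (P : probability T R).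
Variables (om omh : nat -> T -> Omega) (gamma : nat -> R) (x xh : nat -> T -> 'rV[R]_n).
Hypothesis om_meas : forall k, measurable_fun setT (om k).
Hypothesis omh_meas : forall k, measurable_fun setT (omh k).
Hypothesis x0_meas : measurable_fun setT (x 0%N : T -> borelV R n).
Hypothesis x0_in : forall t, X (x 0%N t).
Hypothesis esa : is_ESA X F Fs xi gamma om omh x xh.
Hypothesis gamma_ge0 : forall k, 0 <= gamma k.

Let w k := noise F Fs xi (x k) (om k).
Let wh k := noise F Fs xi (xh k) (omh k).
Hypothesis wh_mean : forall k, cond_mean_zero P (half_history (x 0%N) om omh k) (wh k).
Hypothesis w_sq : forall k, cond_sqnorm_le P (history (x 0%N) om omh k) (w k) nu.
Hypothesis wh_sq : forall k, cond_sqnorm_le P (half_history (x 0%N) om omh k) (wh k) nu.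

Let S := SVI_sol X F.
Let S_convex : convex_set S := SVI_sol_convex X_convex F_lip F_mono.
Let S_compact : compact S := SVI_sol_compact X_convex X_compact F_lip F_mono.
Let X_neq0 : X !=set0. Proof. by case: sol_neq0 => y [Xy _]; exists y. Qed.
Let Xx k t : X (x k t).
Proof. by apply: (iterate_in X_compact X_neq0 x0_in esa). Qed.
Let Xxh k t : X (xh k t).
Proof. by apply: (half_iterate_in X_compact X_neq0 esa). Qed.

Let D k t := dist (x k t) S.

Let D_bounds k t : 0 <= D k t <= 2 * U.
Proof.
by rewrite (dist_sol_ge0 X_convex X_compact F_lip F_mono sol_neq0)
  (dist_sol_le X_convex X_compact F_lip F_mono X_bnd sol_neq0).
Qed.

Let D2_bounds k t : 0 <= D k t ^+ 2 <= 4 * U ^+ 2.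
Proof.
have /andP[D0 DU] := D_bounds k t.
rewrite sqr_ge0/= (_ : 4 * _ = (2 * U) ^+ 2); last by ring.
by rewrite ler_sqr ?nnegrE//; exact: le_trans DU.
Qed.

Lemma measurable_dist_iterate k :
  measurable_fun setT (D k : g_sigma_algebraType (half_history_gen om omh x k) -> R).
Proof.
apply: (measurable_finer (@history_sub_half _ _ _ _ _ _ om omh x k)).
apply: (@measurable_continuous_borelV _ _ _ (g_sigma_algebraType (history_gen om omh x k))
  (fun y => dist y S)); first exact: dist_continuous.
exact: (iterate_measurable X_convex X_compact X_neq0 xi_meas Fs_meas x0_in esa).
Qed.

Let G_meas k := half_history_measurable om_meas omh_meas x0_meas (k := k).

Lemma measurable_dist k : measurable_fun setT (D k).
Proof. exact: (measurable_sub_sigma (@G_meas k) (@measurable_dist_iterate k)). Qed.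

(** The effect of one step on a Lyapunov function [phi] of the squared distance to
the solution set, [phi'] playing the role of its derivative. *)
Lemma expected_lyapunov_step (phi phi' : R -> R) (K' K C : R) k :
    measurable_fun setT phi -> measurable_fun setT phi' -> 0 <= C ->
    (forall a, 0 <= a <= 4 * U ^+ 2 -> `|phi a| <= K' /\ 0 <= phi' a <= K) ->
    (forall a b, 0 <= a <= 4 * U ^+ 2 -> 0 <= b <= 4 * U ^+ 2 ->
       phi b <= phi a + phi' a * (b - a) + C * (b - a) ^+ 2) ->
  \int[P]_t phi (D k.+1 t ^+ 2) <= \int[P]_t phi (D k t ^+ 2)
    - 2 * gamma k * alpha * (\int[P]_t (phi' (D k t ^+ 2) * D k t))
    + gamma k ^+ 2 * (K * (alpha ^+ 2 + 3 * B ^+ 2 + 6 * nu ^+ 2)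
                      + C * (8 * U ^+ 2 * B ^+ 2 + 32 * U ^+ 2 * nu ^+ 2)).
Proof.
move=> mphi mphi' C0 phiK phiT.
have K0 : 0 <= K.
  by have [_ /andP[h1 h2]] := phiK _ (D2_bounds k point); exact: le_trans h2.
have U0 : 0 <= U by have := D_bounds k point; lra.
have g0 := gamma_ge0 k.
have mD2 j : measurable_fun setT (fun t => D j t ^+ 2).
  by apply: measurable_funX; exact: measurable_dist.
have iphi j : P.-integrable setT (EFin \o (fun t => phi (D j t ^+ 2))).
  apply: (@bounded_integrable _ _ _ _ _ K'); first exact: (measurableT_comp mphi).
  by move=> t; case: (phiK _ (D2_bounds j t)).
have iphiD : P.-integrable setT (EFin \o (fun t => phi' (D k t ^+ 2) * D k t)).
  apply: (@bounded_integrable _ _ _ _ _ (K * (2 * U))).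
    apply: measurable_funM; last exact: measurable_dist.
    exact: (measurableT_comp mphi').
  move=> t; have [_ /andP[p0 pK]] := phiK _ (D2_bounds k t).
  have /andP[D0 DU] := D_bounds k t.
  by rewrite normrM !ger0_norm//; apply: ler_pM.
(* the direction paired with the noise of the half step, half-history measurable *)
pose Y t := (2 * gamma k * phi' (D k t ^+ 2)) *: (xh k t - Defs.proj S (x k t)).
have mY i : measurable_fun setT
    (fun t : g_sigma_algebraType (half_history_gen om omh x k) => Y t ord0 i).
  rewrite (_ : (fun t => _) = fun t => (2 * gamma k * phi' (D k t ^+ 2)) *
    (xh k t ord0 i - Defs.proj S (x k t) ord0 i)); last first.
    by apply/funext => t; rewrite !mxE.
  apply: measurable_funM.
    apply: measurable_funM; first exact: measurable_cst.
    apply: (measurableT_comp mphi'); apply: measurable_funX.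
    exact: measurable_dist_iterate.
  apply: measurable_funB.
    apply: measurable_coord.
    exact: (half_iterate_measurable X_convex X_compact X_neq0 xi_meas Fs_meas x0_in esa).
  apply: (measurable_finer (@history_sub_half _ _ _ _ _ _ om omh x k)).
  apply: (@measurable_continuous_borelV _ _ _ (g_sigma_algebraType (history_gen om omh x k))
    (fun y => Defs.proj S y ord0 i)); first exact: proj_coord_continuous.
  exact: (iterate_measurable X_convex X_compact X_neq0 xi_meas Fs_meas x0_in esa).
have YB t i : `|Y t ord0 i| <= 2 * gamma k * K * (2 * U).
  have [_ /andP[p0 pK]] := phiK _ (D2_bounds k t).
  have [Xp _] := proj_in S_compact sol_neq0 (x k t).
  rewrite mxE normrM ger0_norm ?mulr_ge0//; apply: ler_pM => //.
  - by rewrite !mulr_ge0.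
  - by rewrite ler_wpM2l// mulr_ge0.
  - apply: le_trans (coord_le_enorm _ i) _; apply: le_trans (enormD _ _) _.
    by rewrite enormN; have := X_bnd (Xxh k t); have := X_bnd Xp; rewrite /S; lra.
have [iY EY] := cond_mean_zero_orthogonal (@G_meas k) (wh_mean k) mY YB.
have [iw Ew] := cond_sqnorm_le_Rintegral (w_sq k).
have [iwh Ewh] := cond_sqnorm_le_Rintegral (wh_sq k).
have [c0 c0E] : {c : R | c = K * (alpha ^+ 2 + 3 * B ^+ 2) + C * (8 * U ^+ 2 * B ^+ 2)}.
  by exists (K * (alpha ^+ 2 + 3 * B ^+ 2) + C * (8 * U ^+ 2 * B ^+ 2)).
set c1 := 3 * K.
set c2 := 3 * K + C * (32 * U ^+ 2).
have c10 : 0 <= c1 by rewrite mulr_ge0.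
have c20 : 0 <= c2 by rewrite addr_ge0 ?mulr_ge0 ?sqr_ge0.
have pointwise t : phi (D k.+1 t ^+ 2)
      + (2 * gamma k * alpha * (phi' (D k t ^+ 2) * D k t) + dotv (Y t) (wh k t)) <=
    phi (D k t ^+ 2) + gamma k ^+ 2 *
      (c0 + (c1 * enorm (w k t) ^+ 2 + c2 * enorm (wh k t) ^+ 2)).
  have [vE pE] := esa k t.
  have step := sqr_dist_extragradient X_convex X_compact F_lip F_bnd F_mono F_sharp
    (ltW alpha_gt0) sol_neq0 g0 (Xx k t) vE pE.
  have lip := dist_extragradient_lip X_convex X_compact F_lip F_mono X_bnd
    sol_neq0 g0 (Xx k t) pE.
  have H2 := sqr_enormD_le (F (xh k t)) (wh k t).
  have F2 : enorm (F (xh k t)) ^+ 2 <= B ^+ 2 / 4.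
    have Fb := F_bnd (Xxh k t); have F0 := enorm_ge0 (F (xh k t)).
    rewrite (_ : B ^+ 2 / 4 = (B / 2) ^+ 2); last by field.
    by rewrite ler_sqr ?nnegrE//; exact: le_trans Fb.
  have [_ /andP[p0 pK]] := phiK _ (D2_bounds k t).
  have := phiT _ _ (D2_bounds k t) (D2_bounds k.+1 t).
  move: step lip p0 pK; rewrite -/(w k t) -/(wh k t) -/S -/(D k.+1 t) -/(D k t).
  rewrite /Y dotvZl (dotvC (_ - _)).
  move: (dotv _ _) (D k.+1 t ^+ 2) (D k t) => r b e step lip p0 pK hphi.
  have lip' : (b - e ^+ 2) ^+ 2 <= 16 * U ^+ 2 * gamma k ^+ 2 *
      (2 * (B ^+ 2 / 4 + enorm (wh k t) ^+ 2)).
    apply: le_trans lip _; rewrite ler_wpM2l ?mulr_ge0 ?sqr_ge0//.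
    by apply: le_trans H2 _; rewrite ler_pM2l// lerD2r.
  have {lip lip'} := ler_wpM2l C0 lip'.
  move: step hphi p0 pK {H2 F2}; rewrite c0E /c1 /c2.
  have : 0 <= enorm (w k t) ^+ 2 by exact: sqr_ge0.
  have : 0 <= enorm (wh k t) ^+ 2 by exact: sqr_ge0.
  move: (enorm (w k t) ^+ 2) (enorm (wh k t) ^+ 2) => W W' W'0 W0.
  have := sqr_ge0 alpha; have := sqr_ge0 B; have := sqr_ge0 (gamma k).
  move: (phi (e ^+ 2)) (phi' (e ^+ 2)) (phi b) => fe f fb.
  move=> g2 B2 a2 step hphi p0 pK lip.
  have s0 : 0 <= alpha ^+ 2 + 3 * (B ^+ 2 + W + W').
    by apply: addr_ge0 => //; apply: mulr_ge0 => //; rewrite !addr_ge0.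
  have := ler_wpM2l p0 step.
  have := ler_wpM2r (mulr_ge0 g2 s0) pK.
  lra.
have iwwh : P.-integrable setT (EFin \o (fun t =>
    c1 * enorm (w k t) ^+ 2 + c2 * enorm (wh k t) ^+ 2)).
  by apply: integrable_addr; exact: integrable_mull.
have ic : P.-integrable setT (EFin \o (fun _ : T => c0)).
  by apply: (@bounded_integrable _ _ _ _ _ `|c0|) => //; exact: measurable_cst.
have := le_Rintegral measurableT
  (integrable_addr (iphi k.+1)
    (integrable_addr (integrable_mull (2 * gamma k * alpha) iphiD) iY))
  (integrable_addr (iphi k) (integrable_mull (gamma k ^+ 2) (integrable_addr ic iwwh)))
  (fun t _ => pointwise t).
rewrite !RintegralD//; try exact: integrable_mull; try exact: integrable_addr;
  try (by apply: integrable_addr => //; exact: integrable_mull);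
  try (by apply: integrable_mull; exact: integrable_addr).
rewrite RintegralZl// EY addr0 RintegralZl//; last exact: integrable_addr.
rewrite !RintegralD//; try exact: integrable_mull.
rewrite !RintegralZl// Rintegral_cst// -[X in fine X]/(P setT) probability_setT /= mulr1.
move=> Emain; rewrite addrAC lerBrDr; apply: le_trans Emain _.
rewrite lerD2l ler_wpM2l ?sqr_ge0//.
rewrite [leRHS](_ : _ = c0 + (c1 * nu ^+ 2 + c2 * nu ^+ 2)); last first.
  by rewrite c0E /c1 /c2; ring.
by rewrite lerD2l; apply: lerD; exact: ler_wpM2l.
Qed.

(** ** Rates for the steps [gamma0 / k] *)

Variable gamma0 : R.
Hypotheses (gamma0_gt0 : 0 < gamma0) (gammaE : gamma = steplength gamma0).

Let U_ge0 : 0 <= U.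
Proof. by have := D_bounds 0%N point; lra. Qed.

Let iD k : P.-integrable setT (EFin \o D k).
Proof.
apply: (@bounded_integrable _ _ _ _ _ (2 * U)); first exact: measurable_dist.
by move=> t; have := D_bounds k t => /andP[D0 DU]; rewrite ger0_norm.
Qed.

Lemma integrable_dist2 k : P.-integrable setT (EFin \o (fun t => D k t ^+ 2)).
Proof.
apply: (@bounded_integrable _ _ _ _ _ (4 * U ^+ 2)).
  by apply: measurable_funX; exact: measurable_dist.
by move=> t; have /andP[D0 DU] := D2_bounds k t; rewrite ger0_norm.
Qed.

Let iD2 k : P.-integrable setT (EFin \o (fun t => D k t ^+ 2)).
Proof. exact: integrable_dist2. Qed.

(** The rate obtained with [phi] the identity, when the steps are long enough.  The
factor 2 in [s0] makes [7 * s0 / (4 * sigma ^+ 2)] larger than twice the error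
coefficient [gamma0 ^+ 2 * (s0 / 2)], as [recursion_rate] requires. *)
Lemma dist2_rate_quadratic (sigma := alpha / (2 * U))
    (s0 := 2 * (alpha ^+ 2 + 3 * B ^+ 2 + 6 * nu ^+ 2)) :
  3 / 2 <= 2 * gamma0 * sigma <= 2 -> forall k, (0 < k)%N ->
  \int[P]_t (D k t ^+ 2) <=
    Num.max (7 * s0 / (4 * sigma ^+ 2)) (\int[P]_t (D 0%N t ^+ 2)) / k%:R.
Proof.
move=> /andP[c1 c2].
have sigma_gt0 : 0 < sigma.
  have g2 : 0 < 2 * gamma0 by rewrite mulr_gt0.
  by rewrite -(pmulr_rgt0 _ g2); apply: lt_le_trans c1; rewrite divr_gt0.
have U0 : 0 < U.
  by move: sigma_gt0; rewrite /sigma pmulr_rgt0// invr_gt0 pmulr_rgt0.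
set q := alpha ^+ 2 + 3 * B ^+ 2 + 6 * nu ^+ 2.
have q0 : 0 <= q.
  by rewrite /q; have := sqr_ge0 alpha; have := sqr_ge0 B; have := sqr_ge0 nu; lra.
pose a k := \int[P]_t (D k t ^+ 2).
have a0 k : 0 <= a k by apply: Rintegral_ge0 => t _; exact: sqr_ge0.
have step k : a k.+1 <= a k - 2 * gamma k * sigma * a k + gamma k ^+ 2 * q.
  have mid : measurable_fun setT (fun b : R => b) by exact: measurable_id.
  have m1 : measurable_fun setT (fun b : R => 1 : R) by exact: measurable_cst.
  have := @expected_lyapunov_step (fun b => b) (fun=> 1) (4 * U ^+ 2) 1 0 k mid m1 (lexx 0).
  rewrite mul0r addr0 mul1r => h.
  apply: le_trans (h _ _) _.
  - by move=> b /andP[b0 bU]; rewrite ger0_norm//= ler01 lexx.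
  - by move=> b c _ _; rewrite mul1r mul0r addr0 addrC subrK.
  - rewrite lerD2r lerD2l lerN2 -!mulrA ler_pM2l// ler_wpM2l ?gamma_ge0//.
    under [in leRHS]eq_Rintegral do rewrite mul1r.
    rewrite (ler_pM2l alpha_gt0) -RintegralZl//; apply: le_Rintegral => //.
      exact: integrable_mull.
    move=> t _; have /andP[D0 DU] := D_bounds k t.
    by rewrite expr2 mulrA ler_piMl// mulrC ler_pdivrMr ?mulr_gt0// mul1r.
have g2 : gamma0 ^+ 2 * q <= q / sigma ^+ 2.
  rewrite ler_pdivlMr ?exprn_gt0// mulrAC -exprMn -[leRHS]mul1r ler_wpM2r//.
  rewrite expr_le1//; last by rewrite mulr_ge0 // ltW.
  by lra.
have sE : 7 * s0 / (4 * sigma ^+ 2) = 7 / 2 * (q / sigma ^+ 2).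
  by rewrite /s0 -/q; field; rewrite gt_eqF.
have qs0 : 0 <= q / sigma ^+ 2 by rewrite divr_ge0 ?sqr_ge0.
apply: (@recursion_rate _ a (gamma0 ^+ 2 * q)) => //.
- move=> k k0; apply: le_trans (step k) _.
  rewrite gammaE /steplength gtn_eqF//.
  have ak : 0 <= a k / k%:R by rewrite divr_ge0.
  rewrite [X in _ + X <= _](_ : _ = gamma0 ^+ 2 * q / k%:R ^+ 2); last first.
    by rewrite expr_div_n mulrAC.
  rewrite lerD2r lerD2l lerN2.
  rewrite (_ : 2 * (gamma0 / k%:R) * sigma * a k =
    2 * gamma0 * sigma * (a k / k%:R)); last by ring.
  by rewrite ler_wpM2r.
(* the first step has length [gamma0], and [2 gamma0 sigma >= 1] *)
- apply: le_trans (step 0%N) _; rewrite gammaE /steplength eqxx le_max sE.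
  apply/orP; left.
  have := ler_wpM2r (a0 0%N) c1; have := a0 0%N; lra.
- by rewrite le_max sE; apply/orP; left; lra.
Qed.

(** The rate for every positive [gamma0], obtained with
[phi b = expR (lam * b) - 1]. *)
Lemma dist2_rate_exponential (lam := (alpha * gamma0) ^- 2) :
  forall k, (0 < k)%N -> \int[P]_t (D k t ^+ 2) <=
    (expR (lam * (4 * U ^+ 2)) + 2 * (gamma0 ^+ 2 * exp_rate_constant B nu alpha U lam))
      / lam / k%:R.
Proof.
have ag0 : 0 < alpha * gamma0 by rewrite mulr_gt0.
have lam0 : 0 < lam by rewrite invr_gt0 exprn_gt0.
set q := exp_rate_constant B nu alpha U lam.
set e1 := expR (lam * (4 * U ^+ 2)).
have e10 : 0 < e1 by exact: expR_gt0.
have q0 : 0 <= q by exact/exp_rate_constant_ge0/ltW.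
pose phi (b : R) := expR (lam * b) - 1.
pose phi' (b : R) := lam * expR (lam * b).
have mexp : measurable_fun setT (fun b : R => expR (lam * b)).
  apply: measurableT_comp; first exact: measurable_expR.
  by apply: measurable_funM => //; exact: measurable_cst.
have mphi : measurable_fun setT phi.
  by apply: measurable_funB => //; exact: measurable_cst.
have mphi' : measurable_fun setT phi'.
  by apply: measurable_funM => //; exact: measurable_cst.
have expB b : 0 <= b <= 4 * U ^+ 2 -> 1 <= expR (lam * b) <= e1.
  move=> /andP[b0 bU]; rewrite ler_expR ler_pM2l// bU andbT.
  by rewrite -expR0 ler_expR mulr_ge0// ltW.
pose a k := \int[P]_t phi (D k t ^+ 2).
have iphi k : P.-integrable setT (EFin \o (fun t => phi (D k t ^+ 2))).
  apply: (@bounded_integrable _ _ _ _ _ e1).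
    apply: (measurableT_comp mphi).
    by apply: measurable_funX; exact: measurable_dist.
  move=> t; have := expB _ (D2_bounds k t); rewrite /phi ler_norml; lra.
have iphiD k : P.-integrable setT (EFin \o (fun t => phi' (D k t ^+ 2) * D k t)).
  apply: (@integrable_bounded_mul _ _ _ _ _ _ (lam * e1)) => //.
    apply: (measurableT_comp mphi').
    by apply: measurable_funX; exact: measurable_dist.
  move=> t; have /andP[ea eb] := expB _ (D2_bounds k t); rewrite /phi'.
  by rewrite normrM !gtr0_norm ?expR_gt0// ler_pM2l.
have a0 k : 0 <= a k.
  apply: Rintegral_ge0 => t _.
  have := expB _ (D2_bounds k t); rewrite /phi; lra.
have Da k : \int[P]_t (D k t ^+ 2) <= a k / lam.
  rewrite ler_pdivlMr// mulrC -RintegralZl//; apply: le_Rintegral => //.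
    exact: integrable_mull.
  by move=> t _; have := expR_ge1Dx (lam * D k t ^+ 2); rewrite /phi; lra.
(* near the solutions the drift dominates because [d <= alpha * gamma0], far
   from them because [lam * (alpha * gamma0) * d >= 1] *)
have drift r : 0 <= r -> phi (r ^+ 2) <= alpha * gamma0 * (phi' (r ^+ 2) * r).
  move=> r0; rewrite /phi /phi'; have [rs|rl] := lerP r (alpha * gamma0).
    have h : expR (lam * r ^+ 2) * (1 - lam * r ^+ 2) <= 1.
      rewrite -[leRHS](mulfV (lt0r_neq0 (expR_gt0 (lam * r ^+ 2)))) ler_pM2l ?expR_gt0//.
      by rewrite -expRN; have := expR_ge1Dx (- (lam * r ^+ 2)); lra.
    have h2 : lam * expR (lam * r ^+ 2) * r * r <=
        lam * expR (lam * r ^+ 2) * r * (alpha * gamma0).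
      by rewrite ler_wpM2l// !mulr_ge0 ?expR_ge0// ltW.
    lra.
  have h : 1 <= lam * (alpha * gamma0) * r.
    rewrite /lam -(ler_pM2l ag0) mulr1 [leRHS](_ : _ = r).
      exact: ltW.
    by field; rewrite !gt_eqF.
  have := ler_wpM2r (expR_ge0 (lam * r ^+ 2)) h; lra.
have step k : a k.+1 <= a k - 2 * gamma k * alpha *
    (\int[P]_t (phi' (D k t ^+ 2) * D k t)) + gamma k ^+ 2 * q.
  apply: (@expected_lyapunov_step phi phi' e1 (lam * e1)
    (e1 * (2 + 4 * e1) * lam ^+ 2)) => //.
  - by apply: mulr_ge0; rewrite ?sqr_ge0// mulr_ge0 ?(ltW e10)//; lra.
  - move=> b hb; have /andP[h1 h2] := expB _ hb; split.
      by rewrite /phi ler_norml; lra.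
    by rewrite /phi' (mulr_ge0 (ltW lam0)) ?ler_pM2l//; lra.
  - move=> b c hb hc; have /andP[h1 h2] := expB _ hb.
    have bc : lam * (c - b) <= lam * (4 * U ^+ 2) by rewrite ler_pM2l//; lra.
    have := expR_le_quadratic bc; rewrite -/e1 => h3.
    have -> : phi c = expR (lam * b) * expR (lam * (c - b)) - 1.
      by rewrite -expRD /phi; congr (expR _ - 1); ring.
    have := ler_wpM2l (expR_ge0 (lam * b)) h3.
    have k0 : 0 <= (2 + 4 * e1) * (lam * (c - b)) ^+ 2.
      by rewrite mulr_ge0 ?sqr_ge0//; lra.
    have := ler_wpM2r k0 h2; rewrite /phi /phi'.
    move: (expR (lam * b)) (expR (lam * (c - b))) => x1 x2.
    rewrite exprMn; lra.
move=> k k0; apply: le_trans (Da k) _; rewrite mulrAC ler_pM2r ?invr_gt0 ?exprn_gt0//.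
apply: (@recursion_rate _ a (gamma0 ^+ 2 * q)) => //.
- move=> j j0; apply: le_trans (step j) _.
  rewrite gammaE /steplength gtn_eqF//.
  have aj : 0 <= a j / j%:R by rewrite divr_ge0.
  rewrite [X in _ + X <= _](_ : _ = gamma0 ^+ 2 * q / j%:R ^+ 2); last first.
    by rewrite expr_div_n mulrAC.
  rewrite lerD2r lerD2l lerN2.
  have h : a j <= alpha * gamma0 * \int[P]_t (phi' (D j t ^+ 2) * D j t).
    rewrite -RintegralZl//; apply: le_Rintegral => //.
      exact: integrable_mull.
    by move=> t _; apply: drift; have /andP[] := D_bounds j t.
  have j1 : 0 <= j%:R^-1 :> R by rewrite invr_ge0.
  have := ler_wpM2r j1 h.
  move: aj; move: (j%:R^-1) (\int[P]_t _) => c I; lra.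
- apply: le_trans (_ : e1 <= _); last first.
    rewrite lerDl; apply: mulr_ge0 => //; apply: mulr_ge0 => //; exact: sqr_ge0.
  rewrite -[leRHS](_ : \int[P]_t e1 = e1); last first.
    by rewrite Rintegral_cst// -[X in fine X]/(P setT) probability_setT mulr1.
  apply: le_Rintegral => //.
    by apply: (@bounded_integrable _ _ _ _ _ e1) => // t; rewrite gtr0_norm.
  by move=> t _; have := expB _ (D2_bounds 1 t); rewrite /phi; lra.
- by rewrite lerDr ltW.
Qed.

End expected_recursion.

(** * The rates of the extragradient scheme *)

Unset Implicit Arguments.

Lemma steplength_gt0 (R : realType) (gamma0 : R) :
  series (steplength gamma0) @ \oo --> +oo -> 0 < gamma0.
Proof.
move=> /cvgryPgt /(_ 0) [N _ /(_ N (leqnn _)) /= sN].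
rewrite ltNge; apply/negP => g0; move: sN; rewrite ltNge => /negP; apply.
rewrite /series/=; apply: sumr_le0 => k _; rewrite /steplength.
case: (ltnP 0 k) => [k0|]; last by rewrite leqn0 => ->.
by rewrite gtn_eqF// pmulr_lle0// invr_gt0 ltr0n.
Qed.

Theorem proposition6 (R : realType) (n d : nat)
  (X : set 'rV[R]_n) (X_closed : closed X) (X_convex : convex_set X)
  (dO : measure_display) (Omega : measurableType dO) (P0 : probability Omega R)
  (xi : Omega -> 'rV[R]_d)
  (xi_meas : measurable_fun setT (xi : Omega -> borelV R d))
  (Fs : 'rV[R]_n -> 'rV[R]_d -> 'rV[R]_n)
  (Fs_meas : measurable_fun ((X : set (borelV R n)) `*` [set: borelV R d])
     (fun p : borelV R n * borelV R d => (Fs p.1 p.2 : borelV R n)))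
  (Fs_int : forall x, X x -> forall i : 'I_n,
     P0.-integrable setT (fun o => (Fs x (xi o) ord0 i)%:E))
  (F : 'rV[R]_n -> 'rV[R]_n)
  (F_mean : forall x, X x -> F x = mean_map P0 xi Fs x)
  (L B nu alpha U : R)
  (L_gt0 : 0 < L) (B_gt0 : 0 < B) (nu_gt0 : 0 < nu) (alpha_gt0 : 0 < alpha)
  (F_lip : forall x y, X x -> X y -> enorm (F x - F y) <= L * enorm (x - y))
  (F_bnd : forall x, X x -> enorm (F x) <= B / 2)
  (F_mono : monotone_over X F)
  (F_sharp : weakly_sharp X F alpha)
  (X_compact : compact X)
  (X_bnd : forall x, X x -> enorm x <= U) :
  exists (M : R -> R) (s0 : R), 0 < s0 /\
    forall (dT : measure_display) (T : measurableType dT) (P : probability T R)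
      (om omh : nat -> T -> Omega) (gamma0 : R) (x xh : nat -> T -> 'rV[R]_n),
    let gamma := steplength gamma0 in
    let Fk := history (x 0%N) om omh in
    let Fkh := half_history (x 0%N) om omh in
    let w := fun k => noise F Fs xi (x k) (om k) in
    let wh := fun k => noise F Fs xi (xh k) (omh k) in
    let dist2 := fun k t => dist (x k t) (SVI_sol X F) ^+ 2 in
    let sigma := alpha / (2 * U) in
    (forall k, measurable_fun setT (om k)) ->
    (forall k, measurable_fun setT (omh k)) ->
    measurable_fun setT (x 0%N : T -> borelV R n) ->
    (forall t, X (x 0%N t)) ->
    is_ESA X F Fs xi gamma om omh x xh ->
    (forall k, cond_mean_zero P (Fk k) (w k) /\
               cond_mean_zero P (Fkh k) (wh k)) ->
    (forall k, cond_sqnorm_le P (Fk k) (w k) nu /\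
               cond_sqnorm_le P (Fkh k) (wh k) nu) ->
    cvgn (series (fun k => gamma k ^+ 2)) ->
    series gamma @ \oo --> +oo ->
    (forall k, (0 < k)%N -> ('E_P[dist2 k] <= (M gamma0 / k%:R)%:E)%E) /\
    (forall epsilon, 0 < epsilon < 2^-1 ->
       gamma0 = (2 - epsilon) / (2 * sigma) ->
       forall k, (0 < k)%N ->
       ('E_P[dist2 k] <= (k%:R^-1)%:E *
          maxe (7 * s0 / (4 * sigma ^+ 2))%:E 'E_P[dist2 0%N])%E).

Proof.
pose q := alpha ^+ 2 + 3 * B ^+ 2 + 6 * nu ^+ 2.
pose lam g : R := (alpha * g) ^- 2.
pose M g := (expR (lam g * (4 * U ^+ 2)) +
  2 * (g ^+ 2 * exp_rate_constant B nu alpha U (lam g))) / lam g.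
have q0 : 0 < q.
  by rewrite /q; have := exprn_gt0 2 alpha_gt0; have := sqr_ge0 B; have := sqr_ge0 nu; lra.
exists M, (2 * q); split; first by rewrite mulr_gt0.
move=> dT T P om omh gamma0 x xh gamma Fk Fkh w wh dist2 sigma.
move=> om_meas omh_meas x0_meas x0_in esa means sqs _ gamma_oo.
have gamma0_gt0 : 0 < gamma0 := steplength_gt0 _ _ gamma_oo.
have gamma_ge0 k : 0 <= gamma k.
  by rewrite /gamma /steplength; case: ifP => _; rewrite ?divr_ge0// ltW.
have lam_ge0 g : 0 <= lam g by rewrite invr_ge0 sqr_ge0.
(* the distance to the empty set is 0 *)
have [S0|/set0P S0] := eqVneq (SVI_sol X F) set0.
  have E0 k : ('E_P[dist2 k] = 0)%E.
    rewrite unlock (_ : (fun t => _) = cst 0%E) ?integral0//.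
    by apply/funext => t; rewrite /dist2 /dist S0 image_set0 inf0 expr0n.
  split=> [k k0|eps eps01 gE k k0]; rewrite !E0.
    rewrite lee_fin divr_ge0// divr_ge0// addr_ge0 ?expR_ge0//.
    apply: mulr_ge0 => //; apply: mulr_ge0; first exact: sqr_ge0.
    exact: exp_rate_constant_ge0.
  by rewrite mule_ge0// ?lee_fin ?invr_ge0// le_max lexx orbT.
have wh_mean k := (means k).2; have w_sq k := (sqs k).1; have wh_sq k := (sqs k).2.
have ED k : ('E_P[dist2 k] = (\int[P]_t dist2 k t)%R%:E)%E.
  rewrite unlock /Rintegral fineK//; apply: integrable_fin_num => //.
  exact: (integrable_dist2 X_convex X_compact xi_meas Fs_meas F_lip F_mono X_bnd S0 P
    om_meas omh_meas x0_meas x0_in esa).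
split=> [k k0|eps /andP[eps0 eps12] gE k k0]; rewrite !ED.
  rewrite lee_fin.
  exact: (dist2_rate_exponential X_convex X_compact xi_meas Fs_meas alpha_gt0 F_lip
    F_bnd F_mono F_sharp X_bnd S0 om_meas omh_meas x0_meas x0_in esa gamma_ge0
    wh_mean w_sq wh_sq gamma0_gt0 erefl).
rewrite -EFin_max -EFinM lee_fin mulrC.
apply: (dist2_rate_quadratic X_convex X_compact xi_meas Fs_meas alpha_gt0 F_lip
    F_bnd F_mono F_sharp X_bnd S0 om_meas omh_meas x0_meas x0_in esa gamma_ge0
    wh_mean w_sq wh_sq gamma0_gt0 erefl _ k0).
have sigma_neq0 : sigma != 0.
  by apply: contraTneq gamma0_gt0 => s0; rewrite gE s0 mulr0 invr0 mulr0 ltxx.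
rewrite gE -/sigma (_ : 2 * _ * _ = 2 - eps); last by field.
by apply/andP; split; lra.
Qed.
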